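(* Let $\xi$ be a non-degenerate real-valued random variable such that, for some $M>0$ and some $q\in(0,1)$, $$\sup_{u\in\mathbb{R}}\mathbb{P}\{|\xi-u|\le 1\}\le 1-q\qquad\text{and}\qquad \mathbb{P}\{|\xi|>M\}\le q/2 .$$ Let $\{\xi_k : k\ge 0\}$ be a sequence of independent identically distributed random variables with $\xi_k$ equal in distribution to $\xi$ for every $k\ge 0$. Let $\mathcal{C}_n:=\mathrm{circ}(\xi_0,\ldots,\xi_{n-1})$ be the corresponding $n\times n$ random circulant matrix and let $s_n(\mathcal{C}_n)$ be its smallest singular value. Then, for each $\rho\in(0,1/4)$, $$\mathbb{P}\left(s_n(\mathcal{C}_n)\le n^{-\rho}\right)=O(n^{-2\rho})\qquad (n\to\infty).$$
   Context: For $c_0,\ldots,c_{n-1}\in\mathbb{C}$, $\mathrm{circ}(c_0,\ldots,c_{n-1})$ is the $n\times n$ circulant matrix with first row $(c_0,c_1,\ldots,c_{n-1})$ in which each subsequent row is the cyclic shift of the previous row by one position to the right; i.e. its $(j,k)$ entry, $0\le j,k\le n-1$, is $c_{(k-j)\bmod n}$. *)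

(* Defs.v *)
From HB Require Import structures.
From mathcomp Require Import all_boot all_order all_algebra finmap.
From mathcomp Require Import complex.
From mathcomp Require Import all_classical all_reals all_analysis.

Set Implicit Arguments.
Unset Strict Implicit.
Unset Printing Implicit Defensive.

Import Order.TTheory GRing.Theory Num.Theory.
Import numFieldNormedType.Exports.

Local Open Scope classical_set_scope.
Local Open Scope ring_scope.
Local Open Scope complex_scope.
Local Open Scope sesquilinear_scope.

(* Only c 0, ..., c n.-1 are used. Since j < n, (k + n - j) %% n is the
   representative of k - j modulo n in {0, ..., n - 1} (nat subtraction being
   truncated, n is added first). *)
Definition circ (K : Type) (n : nat) (c : nat -> K) : 'M[K]_n :=
  \matrix_(j < n, k < n) c ((k + n - j) %% n)%N.

Definition singular_values (R : realType) (n : nat) (A : 'M[R[i]]_n) : set R :=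
  [set s | 0 <= s /\ eigenvalue (A ^t* *m A) ((s ^+ 2)%:C)].

(* For n > 0 the set of singular values is finite and nonempty, so that the
   infimum is a minimum; for n = 0 it is empty and the value is 0. *)
Definition smallest_singular_value (R : realType) (n : nat) (A : 'M[R[i]]_n) :
    R :=
  inf (singular_values A).

Section random_variables.
Context d (T : measurableType d) (R : realType) (P : probability T R).
Local Open Scope ereal_scope.

Definition degenerate (X : {RV P >-> R}) : Prop :=
  exists c : R, P [set t | X t = c] = 1.

(* Restricted to measurable sets: a measure is a function on all sets, with
   unspecified values on the non-measurable ones. *)
Definition equal_in_distribution (X Y : {RV P >-> R}) : Prop :=
  forall A : set R, measurable A -> distribution P X A = distribution P Y A.

(* Mutual independence: the product rule for every finite subfamily. *)
Definition independent (X : nat -> {RV P >-> R}) : Prop :=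
  forall (J : {fset nat}) (A : nat -> set R),
    (forall k, measurable (A k)) ->
    P (\bigcap_(k in [set` J]) (X k @^-1` A k)) =
    \prod_(k <- J) P (X k @^-1` A k).

Definition random_circulant (X : nat -> {RV P >-> R}) (n : nat) (t : T) :
    'M[R[i]]_n :=
  circ n (fun k => (X k t)%:C).

End random_variables.

(* Main.v *)
(** The eigenvalues of the real circulant matrix are the sums
    [sum_k xi_k exp(2 pi i j k / n)], and their moduli are its singular values;
    it thus suffices to add up the probabilities that the [j]-th one has modulus at
    most [1 / X], where [X = n ^ rho]. The law of [xi] is discretized, which makes
    each of these probabilities a finite sum, bounded by Esseen's argument with
    finitely many frequencies [y] on a planar grid of radius of order [Y]: the
    averaged characteristic function decays like [exp (- c n min (|y|^2, 1))] as long
    as [|y|] stays below a multiple of the order [m = n / gcd (j, n)], and this gives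
    the bound [C / (Y^2 n)]. One takes [Y] of order [X] if [m >= 4 X], of order [1] for
    the [O(X^2)] other indices, and a one-dimensional grid, with the bound
    [C / sqrt n], for the at most two indices with [n | 2 j], whose eigenvalue is
    real. As [X^4 <= n], the total is [O(X^-2)]. *)
Require Import Defs.
From HB Require Import structures.
From mathcomp Require Import all_boot all_order all_algebra finmap.
From mathcomp Require Import complex.
From mathcomp Require Import all_classical all_reals all_analysis.
From mathcomp Require Import measurable_realfun zify ring lra.

Set Implicit Arguments.
Unset Strict Implicit.
Unset Printing Implicit Defensive.

Import Order.TTheory GRing.Theory Num.Theory.
Import numFieldNormedType.Exports.

Local Open Scope classical_set_scope.
Local Open Scope ring_scope.

(** * Quadratic bounds for the cosine and periodic sums *)

Section Trigonometry.
Context {R : realType}.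
Implicit Types (x y z t a b : R) (k m n s j : nat).

Lemma sin_mean_value t : 0 <= t ->
  exists2 c, 0 <= c <= t & sin t = cos c * t.
Proof.
move=> t0; have [|c] := @MVT_segment R (@sin R) (@cos R) 0 t t0.
  by apply: continuous_subspaceT => x; exact: continuous_sin.
by rewrite in_itv/= sin0 !subr0 => ct ->; exists c.
Qed.

Lemma sqr_sin_le t : sin t ^+ 2 <= t ^+ 2.
Proof.
wlog t0 : t / 0 <= t.
  move=> h; have [/h//|/ltW t0] := leP 0 t.
  by rewrite -(sqrrN (sin t)) -(sqrrN t) -sinN; apply: h; rewrite oppr_ge0.
have [c _ ->] := @sin_mean_value t t0.
rewrite exprMn ler_piMl ?sqr_ge0// -(cos2Dsin2 c) lerDl sqr_ge0 //.
Qed.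

Lemma cos_half_angle x : 1 - cos x = 2 * sin (x / 2) ^+ 2.
Proof.
rewrite -[X in cos X](_ : (x / 2) *+ 2 = x) ?cos_mulr2n ?cos2sin2.
  by rewrite -mulr_natl; ring.
by rewrite -mulr_natl; field.
Qed.

Lemma one_sub_cos_le x : 1 - cos x <= x ^+ 2 / 2.
Proof. by have := sqr_sin_le (x / 2); rewrite cos_half_angle; nra. Qed.

Lemma one_sub_cos_ge0 x : 0 <= 1 - cos x.
Proof. by rewrite subr_ge0 cos_le1. Qed.

(** By the half-angle formula and the mean value theorem, [sin (x / 2) = cos c * (x / 2)] with
    [0 <= c <= 1 / 2]; the crude bound [cos c >= 1 / 2] gives the constant 1/8. *)
Lemma one_sub_cos_ge x : `|x| <= 1 -> x ^+ 2 / 8 <= 1 - cos x.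
Proof.
wlog x0 : x / 0 <= x.
  move=> h; have [/h//|/ltW x0] := leP 0 x.
  by move=> x1; rewrite -cosN -sqrrN; apply: h; rewrite ?oppr_ge0 ?normrN.
rewrite ger0_norm// => x1; rewrite cos_half_angle.
have [|c /andP[c0 cx] ->] := @sin_mean_value (x / 2); first by rewrite divr_ge0.
have hc := one_sub_cos_le c.
have c2 : 1 / 2 <= cos c by nra.
have : 1 / 4 <= cos c ^+ 2 by nra.
by have := sqr_ge0 (x / 2); rewrite exprMn; nra.
Qed.

(* This is [|u - v|^2 <= 2 |u - 1|^2 + 2 |v - 1|^2] for the unit complex numbers
   [u] and [v] of arguments [x] and [y]. *)
Lemma one_sub_cosB_le x y :
  1 - cos (x - y) <= 2 * (1 - cos x) + 2 * (1 - cos y).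
Proof.
rewrite cosB; have := cos2Dsin2 x; have := cos2Dsin2 y.
have := sqr_ge0 (cos x + cos y - 2); have := sqr_ge0 (sin x + sin y).
set cx := cos x; set cy := cos y; set sx := sin x; set sy := sin y.
move=> h1 h2 h3 h4; nra.
Qed.

Lemma cosD2pin x k : cos (x + pi * 2 * k%:R) = cos x.
Proof. by rewrite -[RHS](periodicn (@cosD2pi R) k) mulr_natr mulr_natr. Qed.

Lemma sinD2pin x k : sin (x + pi * 2 * k%:R) = sin x.
Proof. by rewrite -[RHS](periodicn (@sinD2pi R) k) mulr_natr mulr_natr. Qed.

Lemma sum_shift_periodic (V : nmodType) n s (g : nat -> V) : (forall k, g (k + n)%N = g k) ->
  \sum_(k < n) g (k + s)%N = \sum_(k < n) g k.
Proof.
move=> gn; elim: s => [|s <-]; first by apply: eq_bigr => k _; rewrite addn0.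
rewrite -(big_mkord predT (fun k => g (k + s.+1)%N)).
rewrite -(big_mkord predT (fun k => g (k + s)%N)).
case: n gn => [|n] gn; first by rewrite !big_nil.
rewrite big_nat_recr//= [RHS]big_nat_recl//= add0n addrC; congr (_ + _).
  by rewrite addnS -addSn addnC gn.
by apply: eq_bigr => k _; rewrite addSnnS.
Qed.

End Trigonometry.

(** * Lower bounds for the phase sums *)

Section PhaseSum.
Context {R : realType}.
Implicit Types (x y z : R) (k l n s j : nat).

Definition angle n j : R := pi * 2 * j%:R / n%:R.

(** This governs the decay of the characteristic function of the [j]-th eigenvalue at the frequency
    [(y1, y2)]. A difference [w] between two values of [xi] enters by scaling the frequency to
    [(w * y1, w * y2)]. *)
Definition phase_sum n j (y1 y2 : R) : R :=
  \sum_(k < n) (1 - cos (y1 * cos (angle n j * k%:R) + y2 * sin (angle n j * k%:R))).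

Lemma angle_period n j k : (0 < n)%N ->
  angle n j * (k + n)%:R = angle n j * k%:R + pi * 2 * j%:R.
Proof.
move=> n0; rewrite /angle natrD mulrDr; congr (_ + _).
by rewrite divfK// pnatr_eq0 -lt0n.
Qed.

Lemma angle_mod n j : (0 < n)%N ->
  angle n j = angle n (j %% n) + pi * 2 * (j %/ n)%:R.
Proof.
move=> n0; rewrite /angle {1}(divn_eq j n) natrD natrM.
by field; rewrite pnatr_eq0 -lt0n.
Qed.

Lemma cos_angle_lt1 n j : (0 < n)%N -> ~~ (n %| j)%N -> cos (angle n j) < 1.
Proof.
move=> n0 nj; rewrite angle_mod// cosD2pin -subr_gt0 cos_half_angle.
rewrite mulr_gt0// exprn_even_gt0//= gt_eqF// sin_gt0_pi//.
have j0 : (0 < j %% n)%N by rewrite lt0n.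
have n0' : (0 : R) < n%:R by rewrite ltr0n.
have jn : (j %% n)%:R < n%:R :> R by rewrite ltr_nat ltn_mod.
have -> : angle n (j %% n) / 2 = pi * ((j %% n)%:R / n%:R).
  by rewrite /angle; field; rewrite gt_eqF.
rewrite mulr_gt0 ?pi_gt0 ?divr_gt0 ?ltr0n//=.
by rewrite gtr_pMr ?pi_gt0// ltr_pdivrMr// mul1r.
Qed.

(** Shifting the index by one rotates the vector of the two sums by [angle n j] and, by periodicity,
    leaves it unchanged; a nontrivial rotation fixes only the zero vector. *)
Lemma sum_cos_sin_angle n j : (0 < n)%N -> ~~ (n %| j)%N ->
  \sum_(k < n) cos (angle n j * k%:R) = 0 /\
  \sum_(k < n) sin (angle n j * k%:R) = 0.
Proof.
move=> n0 nj; set C := \sum_(k < n) cos _; set S := \sum_(k < n) sin _.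
have c1 := cos_angle_lt1 n0 nj.
have eC : C = cos (angle n j) * C - sin (angle n j) * S.
  rewrite {1}/C -(@sum_shift_periodic R n 1 (fun k => cos (angle n j * k%:R))).
    rewrite /C /S !mulr_sumr -sumrB; apply: eq_bigr => k _.
    by rewrite natrD mulrDr mulr1 addrC cosD.
  by move=> k; rewrite angle_period// cosD2pin.
have eS : S = sin (angle n j) * C + cos (angle n j) * S.
  rewrite {1}/S -(@sum_shift_periodic R n 1 (fun k => sin (angle n j * k%:R))).
    rewrite /C /S !mulr_sumr -big_split; apply: eq_bigr => k _.
    by rewrite natrD mulrDr mulr1 addrC sinD.
  by move=> k; rewrite angle_period// sinD2pin.
have := cos2Dsin2 (angle n j).
move: c1 eC eS; set c := cos _; set s := sin _ => c1 eC eS cs.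
(* [2 * (1 - c)] is the determinant of the identity minus the rotation. *)
have d0 : 2 * (1 - c) != 0 by rewrite mulf_neq0 ?pnatr_eq0// gt_eqF ?subr_gt0.
have dE : 2 * (1 - c) = (1 - c) ^+ 2 + s ^+ 2 by nra.
have h1 : C * (1 - c) = - (s * S) by rewrite mulrBr mulr1 {1}eC; ring.
have h2 : S * (1 - c) = s * C by rewrite mulrBr mulr1 {1}eS; ring.
have hC : C * (2 * (1 - c)) = 0.
  rewrite dE; transitivity ((C * (1 - c)) * (1 - c) + s * (s * C)); first by ring.
  by rewrite h1 -h2; ring.
have hS : S * (2 * (1 - c)) = 0.
  rewrite dE; transitivity ((S * (1 - c)) * (1 - c) + s * (s * S)); first by ring.
  by rewrite h2 -[s * S]opprK -h1; ring.
by split; apply: (mulIf d0); rewrite mul0r.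
Qed.

Lemma norm_le1_of_sqr x : x ^+ 2 <= 1 -> `|x| <= 1.
Proof. by rewrite -(real_normK (num_real x)) expr_le1. Qed.

(** All the angles are multiples of [pi] here, so the sines vanish, the cosines are 1 or -1, and
    every term equals [1 - cos y]. Only the first coordinate of the frequency is seen. *)
Lemma phase_sum_degenerate n j y : (n %| j * 2)%N -> y ^+ 2 <= 1 ->
  n%:R * y ^+ 2 / 8 <= phase_sum n j y 0.
Proof.
case: n => [|n] nj y1; first by rewrite /phase_sum big_ord0 !mul0r.
case/dvdnP: nj => c jc.
have -> : n.+1%:R * y ^+ 2 / 8 = \sum_(k < n.+1) (y ^+ 2 / 8).
  by rewrite sumr_const card_ord -[RHS]mulr_natl mulrA.
apply: ler_sum => k _; rewrite mul0r addr0.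
have e : angle n.+1 j * k%:R = pi *+ (c * k).
  rewrite -[RHS]mulr_natr natrM mulrA; congr (_ * _).
  have -> : c%:R = j%:R * 2 / n.+1%:R :> R.
    by rewrite -natrM jc natrM mulfK// pnatr_eq0.
  by rewrite /angle; ring.
have s0 : sin (angle n.+1 j * k%:R) = 0.
  rewrite e; elim: (c * k)%N => [|m IH]; first by rewrite sin0.
  by rewrite mulrS addrC (sinDpi (pi *+ m)) IH oppr0.
have c1 := cos2Dsin2 (angle n.+1 j * k%:R).
rewrite s0 expr0n addr0 in c1.
have e2 : (y * cos (angle n.+1 j * k%:R)) ^+ 2 = y ^+ 2 by rewrite exprMn c1 mulr1.
by rewrite -{1}e2; apply/one_sub_cos_ge/norm_le1_of_sqr; rewrite e2.
Qed.

(** Linearizing the square produces cosines and sines of the doubled angle [angle n (j * 2)], whose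
    sums vanish because [n] does not divide [j * 2]. *)
Lemma sum_sqr_angle n j y1 y2 : (0 < n)%N -> ~~ (n %| j * 2)%N ->
  \sum_(k < n) (y1 * cos (angle n j * k%:R) + y2 * sin (angle n j * k%:R)) ^+ 2
  = n%:R * (y1 ^+ 2 + y2 ^+ 2) / 2.
Proof.
move=> n0 nj; have [hC hS] := sum_cos_sin_angle n0 nj.
transitivity (\sum_(k < n) ((y1 ^+ 2 + y2 ^+ 2) / 2
   + ((y1 ^+ 2 - y2 ^+ 2) / 2 * cos (angle n (j * 2) * k%:R)
   + (y1 * y2) * sin (angle n (j * 2) * k%:R)))).
  apply: eq_bigr => k _.
  have -> : angle n (j * 2) * k%:R = (angle n j * k%:R) *+ 2.
    by rewrite -[RHS]mulr_natr /angle natrM; ring.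
  rewrite cos_mulr2n sin_mulr2n.
  have := cos2Dsin2 (angle n j * k%:R).
  set c := cos _; set s := sin _ => cs.
  have -> : c ^+ 2 *+ 2 - 1 = c ^+ 2 - s ^+ 2 by rewrite -[in LHS]cs; ring.
  have -> : (y1 ^+ 2 + y2 ^+ 2) / 2 = (y1 ^+ 2 + y2 ^+ 2) / 2 * (c ^+ 2 + s ^+ 2).
    by rewrite cs mulr1.
  by field.
rewrite big_split/= sumr_const card_ord big_split/= -!mulr_sumr hC hS !mulr0 !addr0.
by rewrite -[LHS]mulr_natl mulrA.
Qed.

Lemma sqr_rotate_le x y1 y2 : (y1 * cos x + y2 * sin x) ^+ 2 <= y1 ^+ 2 + y2 ^+ 2.
Proof.
have cs := cos2Dsin2 x.
have -> : y1 ^+ 2 + y2 ^+ 2 =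
  (y1 * cos x + y2 * sin x) ^+ 2 + (y1 * sin x - y2 * cos x) ^+ 2.
  by rewrite -[LHS]mulr1 -cs; ring.
by rewrite lerDl sqr_ge0.
Qed.

Lemma phase_sum_small n j y1 y2 : (0 < n)%N -> ~~ (n %| j * 2)%N ->
  y1 ^+ 2 + y2 ^+ 2 <= 1 ->
  n%:R * (y1 ^+ 2 + y2 ^+ 2) / 16 <= phase_sum n j y1 y2.
Proof.
move=> n0 nj y_le1.
have -> : n%:R * (y1 ^+ 2 + y2 ^+ 2) / 16 = n%:R * (y1 ^+ 2 + y2 ^+ 2) / 2 / 8 by field.
rewrite -(sum_sqr_angle _ _ n0 nj) mulr_suml; apply: ler_sum => k _.
apply/one_sub_cos_ge/norm_le1_of_sqr.
exact: le_trans (sqr_rotate_le _ _ _) y_le1.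
Qed.

(** The new frequency is [y] rotated by [- x], minus [y]: its phase at [k] is the difference of the
    phases of [y] at [k + s] and at [k]. Apply [one_sub_cosB_le] termwise; both resulting sums equal
    the original one by periodicity, whence the factor 4. *)
Lemma phase_sum_shift n j s y1 y2 : (0 < n)%N ->
  let x := angle n j * s%:R in
  phase_sum n j (y1 * (cos x - 1) + y2 * sin x) (y2 * (cos x - 1) - y1 * sin x)
  <= 4 * phase_sum n j y1 y2.
Proof.
move=> n0; set x := angle n j * s%:R; rewrite /=.
pose t k := y1 * cos (angle n j * k%:R) + y2 * sin (angle n j * k%:R).
have tn k : t (k + n)%N = t k by rewrite /t angle_period// cosD2pin sinD2pin.
have -> : 4 * phase_sum n j y1 y2 =
    \sum_(k < n) (2 * (1 - cos (t (k + s)%N)) + 2 * (1 - cos (t k))).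
  rewrite big_split/= -!mulr_sumr.
  rewrite (@sum_shift_periodic R n s (fun k => 1 - cos (t k))); last first.
    by move=> k; rewrite tn.
  by rewrite -mulrDl; congr (_ * _); ring.
apply: ler_sum => k _; apply: le_trans (one_sub_cosB_le _ _).
rewrite le_eqVlt; apply/orP; left; apply/eqP; congr (1 - cos _).
by rewrite /t natrD (mulrDr (angle n j)) cosD sinD -/x; ring.
Qed.

(* For [1 <= |y|] the plain second-order bound is lost; shifting the index so that
   the phase turns by [2 pi t gcd(j, n) / n] replaces [y] by a vector of length
   comparable to 1. *)
Lemma phase_sum_large n j y1 y2 : (0 < n)%N -> ~~ (n %| j * 2)%N ->
  1 <= y1 ^+ 2 + y2 ^+ 2 ->
  (pi * 2 * (gcdn j n)%:R) ^+ 2 * (y1 ^+ 2 + y2 ^+ 2) <= n%:R ^+ 2 ->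
  n%:R / 1024 <= phase_sum n j y1 y2.
Proof.
move=> n0 nj y_ge1 y_le.
have j0 : (0 < j)%N by case: j nj {y_le} => //; rewrite mul0n dvdn0.
have nR : 0 < n%:R :> R by rewrite ltr0n.
set r2 := y1 ^+ 2 + y2 ^+ 2 in y_ge1 y_le.
pose r := Num.sqrt r2.
have rr : r ^+ 2 = r2 by rewrite sqr_sqrtr// (le_trans ler01).
have r_ge1 : 1 <= r by rewrite -sqrtr1 ler_wsqrtr.
have r0 : 0 < r by exact: lt_le_trans r_ge1.
pose w : R := pi * 2 * (gcdn j n)%:R / n%:R.
have w0 : 0 < w.
  by rewrite /w !mulr_gt0 ?pi_gt0 ?invr_gt0// ltr0n gcdn_gt0 j0.
have wr0 : 0 < w * r by rewrite mulr_gt0.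
have wr : w * r <= 1.
  rewrite -(expr_le1 (n := 2) _ (ltW wr0))//.
  by rewrite exprMn rr /w expr_div_n [leLHS]mulrAC ler_pdivrMr ?exprn_gt0// mul1r.
(* The largest integer with [t * w * r <= 1]. As [t >= 1], one has [t + 1 <= 2 * t], so that
   [t * w * r] is at least 1/2. *)
pose t := Num.truncn ((w * r)^-1).
have wr1 : 1 <= (w * r)^-1 by rewrite invf_ge1.
have /andP[t_le t_lt] : t%:R <= (w * r)^-1 < t.+1%:R.
  by apply: truncn_itv; rewrite ltW// (lt_le_trans ltr01).
have t1 : (1 <= t)%N by rewrite truncn_gt0.
have twr_le : t%:R * (w * r) <= 1.
  by rewrite -ler_pdivlMr// mul1r.
have twr_ge : 1 / 2 <= t%:R * (w * r).
  have : 1 < t.+1%:R * (w * r) by rewrite -ltr_pdivrMr// mul1r.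
  have : 1 <= t%:R :> R by rewrite ler1n.
  rewrite -natr1; nra.
(* By Bezout, [u * j = v * n + gcd (j, n)], so shifting by [u * t] turns the phase by [t * w] modulo
   [2 pi]. *)
have [s x_eq] : exists s, cos (angle n j * s%:R) = cos (t%:R * w) /\
    sin (angle n j * s%:R) = sin (t%:R * w).
  case: (egcdnP n j0) => u v uv _.
  exists (u * t)%N.
  have -> : angle n j * (u * t)%:R = t%:R * w + pi * 2 * (v * t)%:R.
    have uvR : u%:R * j%:R = v%:R * n%:R + (gcdn j n)%:R :> R.
      by rewrite -!natrM -natrD uv.
    have -> : angle n j * (u * t)%:R = pi * 2 * t%:R * (u%:R * j%:R) / n%:R.
      by rewrite /angle natrM; ring.
    by rewrite uvR natrM /w; field; rewrite gt_eqF.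
  by rewrite cosD2pin sinD2pin.
have := @phase_sum_shift n j s y1 y2 n0.
rewrite /= x_eq.1 x_eq.2.
have x0 : 0 <= t%:R * w by rewrite mulr_ge0// ltW.
have xr_le : t%:R * w * r <= 1 by rewrite -mulrA.
have xr_ge : 1 / 2 <= t%:R * w * r by rewrite -mulrA.
move: (t%:R * w) x0 xr_le xr_ge {x_eq twr_le twr_ge} => x x0 xr_le xr_ge shift.
have x1 : x <= 1 by nra.
have x1' : `|x| <= 1 by rewrite ger0_norm.
have cl := one_sub_cos_ge x1'; have cu := one_sub_cos_le x.
set z1 := y1 * _ + _ in shift; set z2 := y2 * _ - _ in shift.
have z2E : z1 ^+ 2 + z2 ^+ 2 = 2 * r2 * (1 - cos x).
  have -> : z1 ^+ 2 + z2 ^+ 2 = r2 * ((cos x - 1) ^+ 2 + sin x ^+ 2).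
    by rewrite /z1 /z2 /r2; ring.
  by rewrite sin2cos2; ring.
have xr2_le : x ^+ 2 * r2 <= 1 by rewrite -rr -exprMn expr_le1// mulr_ge0// ltW.
have xr2_ge : 1 / 4 <= x ^+ 2 * r2 by rewrite -rr -exprMn; nra.
have z_le : z1 ^+ 2 + z2 ^+ 2 <= 1 by rewrite z2E; nra.
have z_ge : 1 / 16 <= z1 ^+ 2 + z2 ^+ 2 by rewrite z2E; nra.
(* The shifted frequency has squared length at least 1/16, hence phase sum at least [n / 256]; the
   factor 4 of the shift gives [n / 1024]. *)
have := phase_sum_small n0 nj z_le; nra.
Qed.

End PhaseSum.

(** * Characteristic functions of finite laws and Esseen's inequality *)

Section Cis.
Context {R : realType}.
Local Open Scope complex_scope.
Import ComplexField.Normc.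
Implicit Types x y : R.

Definition cis x : R[i] := cos x +i* sin x.

Lemma cisD x y : cis (x + y) = cis x * cis y.
Proof. by rewrite /cis cosD sinD; simpc; rewrite [X in _ +i* X]addrC. Qed.

Lemma cis0 : cis 0 = 1.
Proof. by rewrite /cis cos0 sin0. Qed.

Lemma cis_sum (I : Type) (r : seq I) (F : I -> R) :
  cis (\sum_(i <- r) F i) = \prod_(i <- r) cis (F i).
Proof. exact: (big_morph _ cisD cis0). Qed.

Lemma sum_Complex (I : Type) (r : seq I) (P : pred I) (F G : I -> R) :
  \sum_(i <- r | P i) (F i +i* G i)
  = (\sum_(i <- r | P i) F i) +i* (\sum_(i <- r | P i) G i).
Proof.
by elim/big_rec3: _ => // i y1 y2 y3 _ ->; simpc.
Qed.

Lemma Re_prod_le n (F : 'I_n -> R[i]) :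
  complex.Re (\prod_(k < n) F k) <= \prod_(k < n) normc (F k).
Proof.
have <- : normc (\prod_(k < n) F k) = \prod_(k < n) normc (F k).
  by apply: (big_morph _ (@normcM R)); exact: normc1.
case: (\prod_(k < n) F k) => a b /=; apply: (le_trans (ler_norm a)).
by rewrite -sqrtr_sqr ler_wsqrtr// lerDl sqr_ge0.
Qed.

Lemma sqr_sum_cos_sin (L : finType) (w S : L -> R) :
  (\sum_l w l * cos (S l)) ^+ 2 + (\sum_l w l * sin (S l)) ^+ 2
  = \sum_l \sum_l' w l * w l' * cos (S l - S l').
Proof.
rewrite !expr2 !big_distrlr -big_split /=; apply: eq_bigr => l _.
rewrite -big_split /=; apply: eq_bigr => l' _; rewrite cosB; ring.
Qed.

(** The squared modulus is [(\sum_i p i) ^ 2] minus the double sum, hence at most 1 minus the double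
    sum, and [1 - s <= exp (- s)]; taking the square root gives the factor 1/2. Total mass below 1
    is allowed, since the discretized law may lose its tail. *)
Lemma normc_weighted_cis_le (I : finType) (p v : I -> R) (t : R) :
  (forall i, 0 <= p i) -> \sum_i p i <= 1 ->
  normc (\sum_i (p i)%:C * cis (t * v i)) <=
  expR (- (1 / 2) * \sum_i \sum_j p i * p j * (1 - cos (t * (v i - v j)))).
Proof.
move=> p0 p1.
have -> : \sum_i (p i)%:C * cis (t * v i) =
    (\sum_i p i * cos (t * v i)) +i* (\sum_i p i * sin (t * v i)).
  by rewrite -sum_Complex; apply: eq_bigr => i _; rewrite /cis; simpc.
rewrite /normc sqr_sum_cos_sin.
have e0 := expR_ge0 (- (1 / 2) * \sum_i \sum_j p i * p j * (1 - cos (t * (v i - v j)))).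
rewrite -(ger0_norm e0) -sqrtr_sqr ler_wsqrtr// -expRM_natl.
apply: le_trans (expR_ge1Dx _).
have -> : \sum_i \sum_j p i * p j * (1 - cos (t * (v i - v j)))
   = (\sum_i p i) ^+ 2 - \sum_i \sum_j p i * p j * cos (t * v i - t * v j).
  rewrite expr2 big_distrlr -sumrB; apply: eq_bigr => i _.
  by rewrite -sumrB; apply: eq_bigr => j _; rewrite mulrBr mulr1 mulrBr.
have : (\sum_i p i) ^+ 2 <= 1 by rewrite expr_le1// sumr_ge0.
by move=> h; nra.
Qed.

(* The Esseen concentration argument: on the event on the left, every frequency
   contributes a cosine at least 1/2, so that the squared modulus of the sum of the
   exponentials is at least [#|L| ^ 2 / 4]. *)
Lemma sum_concentration_le (I L : finType) n (p v : I -> R) (th : L -> 'I_n -> R)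
    (G : pred {ffun 'I_n -> I}) :
  (forall i, 0 <= p i) -> \sum_i p i <= 1 ->
  (forall f, G f -> forall l, `|\sum_k th l k * v (f k)| <= 1) ->
  (\sum_(f | G f) \prod_k p (f k)) * #|L|%:R ^+ 2 <=
  4 * \sum_l \sum_l' expR (- (1 / 2) * \sum_i \sum_j p i * p j *
         \sum_k (1 - cos ((th l k - th l' k) * (v i - v j)))).
Proof.
move=> p0 p1 hG.
pose S (f : {ffun 'I_n -> I}) l := \sum_k th l k * v (f k).
pose W (f : {ffun 'I_n -> I}) := \prod_k p (f k).
have W0 f : 0 <= W f by exact: prodr_ge0.
pose D f := \sum_l \sum_l' cos (S f l - S f l').
have DE f : D f = (\sum_l cos (S f l)) ^+ 2 + (\sum_l sin (S f l)) ^+ 2.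
  have := @sqr_sum_cos_sin L (fun _ => 1) (S f).
  under eq_bigr do rewrite mul1r.
  under [X in _ + X ^+ 2 = _ -> _]eq_bigr do rewrite mul1r.
  move=> ->; apply: eq_bigr => l _; apply: eq_bigr => l' _; by rewrite !mul1r.
have D_good f : G f -> #|L|%:R ^+ 2 <= 4 * D f.
  move=> Gf; have : #|L|%:R / 2 <= \sum_l cos (S f l).
    have -> : #|L|%:R / 2 = \sum_(l : L) (1 / 2 : R).
      by rewrite sumr_const -[RHS]mulr_natl mul1r.
    apply: ler_sum => l _; have := hG f Gf l; rewrite -/(S f l).
    have := one_sub_cos_le (S f l) => h1 h2.
    have : S f l ^+ 2 <= 1 by rewrite -(real_normK (num_real _)) expr_le1.
    lra.
  move=> h; rewrite DE; have := sqr_ge0 (\sum_l sin (S f l)).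
  have : 0 <= #|L|%:R / 2 :> R by rewrite divr_ge0.
  nra.
have -> : (\sum_(f | G f) \prod_k p (f k)) * #|L|%:R ^+ 2
   = \sum_(f | G f) W f * #|L|%:R ^+ 2 by rewrite mulr_suml.
(* [D f] is a sum of two squares, so the terms with [f] outside [G] may be added. *)
apply: (@le_trans _ _ (4 * \sum_f W f * D f)).
  rewrite mulr_sumr [leLHS]big_mkcond/=; apply: ler_sum => f _.
  have Df : 0 <= D f by rewrite DE addr_ge0 ?sqr_ge0.
  case: ifPn => Gf; last by rewrite !mulr_ge0.
  by rewrite [leRHS]mulrCA; apply: ler_wpM2l => //; exact: D_good.
apply: ler_wpM2l => //.
have -> : \sum_f W f * D f = \sum_l \sum_l' \sum_f W f * cos (S f l - S f l').
  under eq_bigr do rewrite mulr_sumr.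
  rewrite exchange_big/=; apply: eq_bigr => l _.
  under eq_bigr do rewrite mulr_sumr.
  by rewrite exchange_big.
apply: ler_sum => l _; apply: ler_sum => l' _.
pose t k := th l k - th l' k.
(* Independence: the product weights [W] turn the characteristic function of the sum into the
   product of the individual ones. *)
have -> : \sum_f W f * cos (S f l - S f l') =
    complex.Re (\prod_(k < n) \sum_i (p i)%:C * cis (t k * v i)).
  rewrite bigA_distr_bigA/=.
  rewrite (_ : \sum_f _ = \sum_(f : {ffun 'I_n -> I})
      (W f * cos (S f l - S f l')) +i* (W f * sin (S f l - S f l'))).
    by rewrite sum_Complex.
  apply: eq_bigr => f _; rewrite big_split/= -rmorph_prod -cis_sum.
  have -> : \sum_k t k * v (f k) = S f l - S f l'.
    by rewrite -sumrB; apply: eq_bigr => k _; rewrite mulrBl.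
  by rewrite -/(W f) /cis; simpc.
apply: le_trans (Re_prod_le _) _.
apply: (@le_trans _ _ (\prod_(k < n) expR (- (1 / 2) *
    \sum_i \sum_j p i * p j * (1 - cos (t k * (v i - v j)))))).
  apply: ler_prod => k _; rewrite normc_weighted_cis_le// andbT.
  by case: (\sum_i _) => a b; exact: sqrtr_ge0.
rewrite -expR_sum ler_expR -mulr_sumr ler_wnM2l ?oppr_le0//.
rewrite [leRHS]exchange_big/=; apply: ler_sum => i _.
rewrite [leRHS]exchange_big/=; apply: ler_sum => j _.
by rewrite -mulr_sumr.
Qed.

End Cis.

(** * Esseen's inequality on a planar grid of frequencies *)

Section Grid.
Context {R : realType}.

Lemma geometric_sum_le (r : R) m : 0 <= r -> r < 1 ->
  \sum_(i < m) r ^+ i <= (1 - r)^-1.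
Proof.
move=> r0 r1; have d0 : 0 < 1 - r by rewrite subr_gt0.
rewrite -(ler_pM2l d0) divff ?gt_eqF//.
have -> : (1 - r) * \sum_(i < m) r ^+ i = 1 - r ^+ m.
  by rewrite -[in RHS](expr1n R m) subrXX; congr (_ * _);
     apply: eq_bigr => i _; rewrite expr1n mul1r.
by rewrite gerBl exprn_ge0.
Qed.

(** As [k ^ 2 >= k] for a natural number [k], the terms on either side of [a] are dominated by a
    geometric series of ratio [exp (- c)]. *)
Lemma gauss_sum_le (c : R) N a : 0 < c ->
  \sum_(b < N) expR (- c * (a%:R - b%:R) ^+ 2) <= 2 / (1 - expR (- c)).
Proof.
move=> c0; set r := expR (- c).
have r0 : 0 <= r by exact: expR_ge0.
have r1 : r < 1 by rewrite expR_lt1 oppr_lt0.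
pose F b := expR (- c * (a%:R - b%:R) ^+ 2).
have F0 b : 0 <= F b by exact: expR_ge0.
have Fle b k : (a%:R - b%:R) ^+ 2 = k%:R ^+ 2 :> R -> F b <= r ^+ k.
  move=> e; rewrite /F e /r -expRM_natl ler_expR mulrC !mulrN lerN2.
  by rewrite ler_pM2r// -natrX ler_nat; case: k {e} => // k; rewrite expnS expn1 leq_pmulr.
have -> : \sum_(b < N) expR (- c * (a%:R - b%:R) ^+ 2) = \sum_(0 <= b < N) F b.
  by rewrite big_mkord.
apply: (@le_trans _ _ (\sum_(0 <= b < a + N) F b)).
  rewrite [leRHS](@big_cat_nat _ _ _ N)//= ?leq_addl// lerDl.
  by apply: sumr_ge0.
rewrite (@big_cat_nat _ _ _ a)//= ?leq_addr//.
have -> : 2 / (1 - r) = (1 - r)^-1 + (1 - r)^-1 by field; rewrite subr_eq0 gt_eqF.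
apply: lerD.
  rewrite big_nat_rev/= add0n big_mkord.
  apply: le_trans (geometric_sum_le a r0 r1); apply: ler_sum => i _.
  apply: (@le_trans _ _ (r ^+ i.+1)).
    apply: Fle; rewrite natrB//; ring.
  by rewrite exprS ler_piMl ?exprn_ge0// ltW.
rewrite -{1}[a]add0n big_addn big_mkord.
apply: le_trans (geometric_sum_le _ r0 r1); apply: ler_sum => i _.
by apply: Fle; rewrite natrD; ring.
Qed.

(** The coefficient of the [k]-th variable when the real and imaginary parts of the eigenvalue are
    tested against [h * l.1] and [h * l.2]. Taking [N2 = 1] gives the one-dimensional grid. *)
Definition grid_frequency n j N N2 (h : R) (l : 'I_N * 'I_N2) (k : 'I_n) : R :=
  h * (l.1%:R * cos (angle n j * k%:R) + l.2%:R * sin (angle n j * k%:R)).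

(** Here [w] ranges over the relevant differences of values of [xi]. The 64, in place of the 16 of
    [phase_sum_small], absorbs [w ^ 2 >= 1 / 4]. *)
Definition phase_lower_bound n j (B y1 y2 : R) :=
  forall w : R, 1 / 2 <= `|w| -> `|w| <= B ->
  Num.min (n%:R * (y1 ^+ 2 + y2 ^+ 2) / 64) (n%:R / 1024)
  <= phase_sum n j (w * y1) (w * y2).

(** The exponential of minus a minimum is at most the sum of the two exponentials. The constant
    regime contributes the same amount for each pair of frequencies, and the quadratic one factors
    into two Gaussian sums, of sizes [N] and [N2] up to a constant; then divide by the squared
    number of frequencies. The condition on [n%:R * h ^ 2] makes the Gaussian decay uniform in the
    grid indices. *)
Lemma grid_concentration_le (I : finType) n j N N2 (h B kappa : R) (p v : I -> R)
    (G : pred {ffun 'I_n -> I}) :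
  (0 < N)%N -> (0 < N2)%N -> 0 < kappa -> 1 / 4 <= n%:R * h ^+ 2 ->
  (forall i, 0 <= p i) -> \sum_i p i <= 1 ->
  kappa <= \sum_i \sum_(i' | (1 / 2 <= `|v i - v i'|) && (`|v i - v i'| <= B))
     p i * p i' ->
  (forall (a a' : 'I_N) (b b' : 'I_N2),
     phase_lower_bound n j B (h * (a%:R - a'%:R)) (h * (b%:R - b'%:R))) ->
  (forall f, G f -> forall l,
     `|\sum_k @grid_frequency n j N N2 h l k * v (f k)| <= 1) ->
  \sum_(f | G f) \prod_k p (f k) <=
  4 * (expR (- (kappa / 2048) * n%:R) +
       (2 / (1 - expR (- (kappa / 512)))) ^+ 2 / (N%:R * N2%:R)).
Proof.
move=> N0 N20 k0 nh p0 p1 hk hph hG.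
set A := 2 / _; pose L := ('I_N * 'I_N2)%type.
pose E1 := expR (- (kappa / 2048) * n%:R).
pose g (a a' : nat) := expR (- (kappa / 512) * (a%:R - a'%:R) ^+ 2).
have g0 a a' : 0 <= g a a' by exact: expR_ge0.
have NR : 0 < N%:R :> R by rewrite ltr0n.
have N2R : 0 < N2%:R :> R by rewrite ltr0n.
have cL : #|{: L}|%:R = N%:R * N2%:R :> R by rewrite card_prod !card_ord natrM.
have M0 : 0 < N%:R * N2%:R :> R by rewrite mulr_gt0.
have := sum_concentration_le p0 p1 hG.
rewrite cL -ler_pdivlMr ?exprn_gt0// => /le_trans; apply.
rewrite -mulrA; apply: ler_wpM2l => //.
rewrite ler_pdivrMr ?exprn_gt0//.
apply: (@le_trans _ _ (\sum_(l : L) \sum_(l' : L) (E1 + g l.1 l'.1 * g l.2 l'.2))).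
  apply: ler_sum => -[a b] _; apply: ler_sum => -[a' b'] _ /=.
  set y1 := h * (a%:R - a'%:R); set y2 := h * (b%:R - b'%:R).
  pose m := Num.min (n%:R * (y1 ^+ 2 + y2 ^+ 2) / 64) (n%:R / 1024).
  have m0 : 0 <= m.
    rewrite le_min; apply/andP; split; apply: divr_ge0; try exact: ler0n.
    by apply: mulr_ge0; [exact: ler0n | apply: addr_ge0; exact: sqr_ge0].
  have hm : kappa * m <= \sum_i \sum_i' p i * p i' * \sum_(k < n) (1 - cos
      ((grid_frequency j h (a, b) k - grid_frequency j h (a', b') k) * (v i - v i'))).
    (* Pairs of values at a distance outside [[1/2, B]] contribute nonnegative terms and are
       dropped; the others have total weight at least [kappa]. *)
    apply: le_trans (ler_wpM2r m0 hk) _.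
    rewrite mulr_suml; apply: ler_sum => i _.
    rewrite mulr_suml [leLHS]big_mkcond/=; apply: ler_sum => i' _.
    case: ifPn => [/andP[w1 w2]|_]; last first.
      rewrite mulr_ge0 ?mulr_ge0// sumr_ge0// => k _; exact: one_sub_cos_ge0.
    apply: ler_wpM2l; first exact: mulr_ge0.
    apply: le_trans (hph a a' b b' _ w1 w2) _.
    rewrite /phase_sum; apply: ler_sum => k _.
    rewrite le_eqVlt; apply/orP; left; apply/eqP; congr (1 - cos _).
    by rewrite /grid_frequency /=; ring.
  apply: (@le_trans _ _ (expR (- (1 / 2) * (kappa * m)))).
    by rewrite ler_expR ler_wnM2l// oppr_le0.
  rewrite /m; case: (leP (n%:R * (y1 ^+ 2 + y2 ^+ 2) / 64) (n%:R / 1024)) => _.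
    rewrite -[leLHS]add0r; apply: lerD; first exact: expR_ge0.
    rewrite /g -expRD ler_expR /y1 /y2 !exprMn -!mulrDr !mulNr lerN2.
    have : 0 <= (a%:R - a'%:R) ^+ 2 + (b%:R - b'%:R) ^+ 2 :> R.
      by rewrite addr_ge0 ?sqr_ge0.
    set z := _ + _ => z0.
    have : kappa * z * (1 / 4) <= kappa * z * (n%:R * h ^+ 2).
      by rewrite ler_wpM2l// mulr_ge0// ltW.
    nra.
  rewrite -[leLHS]addr0; apply: lerD; last by rewrite mulr_ge0.
  by rewrite /E1 ler_expR !mulNr lerN2; nra.
under eq_bigr do rewrite big_split/= sumr_const.
rewrite big_split/= sumr_const -mulrnA -[X in X + _]mulr_natr natrM cL.
rewrite [leRHS]mulrDl; apply: lerD; first by rewrite -expr2.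
have -> : A ^+ 2 / (N%:R * N2%:R) * (N%:R * N2%:R) ^+ 2 = (N%:R * A) * (N2%:R * A).
  by field; rewrite !gt_eqF.
have -> : \sum_(l : L) \sum_(l' : L) g l.1 l'.1 * g l.2 l'.2
   = (\sum_(a < N) \sum_(a' < N) g a a') * (\sum_(b < N2) \sum_(b' < N2) g b b').
  rewrite big_distrlr/= -(pair_bigA _ (fun (a : 'I_N) (b : 'I_N2) =>
    \sum_(l' : L) g a l'.1 * g b l'.2))/=.
  apply: eq_bigr => a _; apply: eq_bigr => b _.
  rewrite big_distrlr/= -(pair_bigA _ (fun (a' : 'I_N) (b' : 'I_N2) =>
    g a a' * g b b'))//=.
have gs (K : nat) : \sum_(a < K) \sum_(a' < K) g a a' <= K%:R * A.
  have -> : K%:R * A = \sum_(a < K) A by rewrite sumr_const card_ord mulr_natl.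
  apply: ler_sum => a _; rewrite /g /A.
  have k5 : 0 < kappa / 512 by apply: divr_gt0; [|rewrite ltr0n].
  exact: (gauss_sum_le K a k5).
by apply: ler_pM => //; apply: sumr_ge0 => a _; apply: sumr_ge0.
Qed.

End Grid.

(** * Singular values of a real circulant matrix *)

Section Spectrum.
Context {R : realType}.
Local Open Scope complex_scope.
Local Open Scope sesquilinear_scope.
Implicit Types (c : nat -> R).

Definition sqr_eigen_modulus n c j : R :=
  (\sum_(k < n) c k * cos (angle n j * k%:R)) ^+ 2 +
  (\sum_(k < n) c k * sin (angle n j * k%:R)) ^+ 2.

Let eigval n c j : R[i] := \sum_(k < n) cis (angle n j * k%:R) * (c k)%:C.
(** The Fourier vectors are rows because [eigenvalue] refers to row vectors multiplied by the matrix
    on their right. *)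
Let eigvec n j : 'rV[R[i]]_n := \row_k cis (angle n j * k%:R).
Let rcirc n c := circ n (fun k => (c k)%:C).

Lemma conj_cis (x : R) : Num.conj (cis x) = cis (- x).
Proof. by rewrite /cis cosN sinN. Qed.

Lemma conj_real_complex (x : R) : Num.conj (x%:C) = x%:C :> R[i].
Proof. by apply/eqP; rewrite eq_complex/= oppr0 !eqxx. Qed.

Lemma cis_angleD n j k : (0 < n)%N ->
  cis (angle n j * (k + n)%:R) = cis (angle n j * k%:R) :> R[i].
Proof. by move=> n0; rewrite angle_period// /cis cosD2pin sinD2pin. Qed.

Lemma cis_angle_mod n j k : (0 < n)%N ->
  cis (angle n j * (k %% n)%N%:R) = cis (angle n j * k%:R) :> R[i].
Proof.
move=> n0; rewrite [in RHS](divn_eq k n) addnC.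
elim: (k %/ n)%N => [|m IH]; first by rewrite mul0n addn0.
by rewrite mulSnr addnA cis_angleD// IH.
Qed.

Let conj_eigval n c j :
  Num.conj (eigval n c j) = \sum_(k < n) cis (- (angle n j * k%:R)) * (c k)%:C.
Proof.
rewrite rmorph_sum; apply: eq_bigr => k _.
by rewrite rmorphM/= conj_cis conj_real_complex.
Qed.

Let eigval_normE n c j :
  eigval n c j * Num.conj (eigval n c j) = (sqr_eigen_modulus n c j)%:C.
Proof.
have -> : eigval n c j = (\sum_(k < n) c k * cos (angle n j * k%:R)) +i*
    (\sum_(k < n) c k * sin (angle n j * k%:R)).
  rewrite -sum_Complex; apply: eq_bigr => k _.
  by rewrite mulrC /cis; simpc.
rewrite /sqr_eigen_modulus; set a := \sum_(k < n) _; set b := \sum_(k < n) _.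
by rewrite /Num.conj/=; simpc; rewrite !expr2 [X in _ +i* X](_ : _ = 0)//; ring.
Qed.

Let eigvec_mul_adj n c j : eigvec n j *m (rcirc n c)^t* = eigval n c j *: eigvec n j.
Proof.
case: n => [|n]; first by apply/rowP => -[].
apply/rowP => k; rewrite !mxE mulr_suml.
pose g (i : nat) : R[i] := cis (angle n.+1 j * i%:R) * (c ((i + n.+1 - k) %% n.+1)%N)%:C.
rewrite (_ : \sum_i _ = \sum_(i < n.+1) g i); last first.
  by apply: eq_bigr => i _; rewrite !mxE conj_real_complex.
(* The coefficient depends on [i - k] modulo [n]; shifting the index by [k] takes out the [k]-th
   entry of the Fourier vector. *)
rewrite -(@sum_shift_periodic _ n.+1 k); last first.
  move=> i; rewrite /g cis_angleD//; congr (_ * (c _)%:C).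
  by rewrite [(i + _ + _ - _)%N](_ : _ = (i + n.+1 - k + n.+1)%N) ?modnDr//; have := ltn_ord k; lia.
apply: eq_bigr => i _; rewrite /g natrD mulrDr cisD mulrAC; congr (_ * (c _)%:C * _).
by rewrite addnAC addnK modnDr modn_small.
Qed.

Let eigvec_mul n c j : eigvec n j *m rcirc n c = Num.conj (eigval n c j) *: eigvec n j.
Proof.
case: n => [|n]; first by apply/rowP => -[].
apply/rowP => k; rewrite !mxE conj_eigval mulr_suml.
(* The reflection of [i] to [k - i] modulo [n], with [n] added before the truncated subtraction. *)
pose s (i : 'I_n.+1) : 'I_n.+1 := inord ((k + n.+1 - i) %% n.+1).
have sE i : s i = ((k + n.+1 - i) %% n.+1)%N :> nat by rewrite inordK// ltn_mod.
have sK : involutive s.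
  move=> i; apply: val_inj; rewrite /= !sE.
  have := ltn_ord i; have := ltn_ord k => hk hi.
  have [ik|ki] := leqP i k.
    have -> : ((k + n.+1 - i) %% n.+1)%N = (k - i)%N.
      by rewrite (_ : (k + n.+1 - i)%N = (k - i + n.+1)%N) ?modnDr ?modn_small//; lia.
    by rewrite (_ : (k + n.+1 - (k - i))%N = (i + n.+1)%N) ?modnDr ?modn_small//; lia.
  rewrite [((k + n.+1 - i) %% _)%N]modn_small; last by lia.
  by rewrite subKn ?modn_small//; lia.
rewrite (reindex_inj (inv_inj sK)); apply: eq_bigr => i _.
rewrite !mxE [in angle _ _ * _]sE cis_angle_mod//.
have -> : ((k + n.+1 - s i) %% n.+1)%N = i by rewrite -sE sK.
rewrite natrB; last by rewrite (leq_trans (ltnW (ltn_ord i)))// leq_addl.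
by rewrite mulrBr addrC cisD cis_angleD// mulrAC.
Qed.

Lemma trCmx_mul_adj_self n (A : 'M[R[i]]_n) : (A ^t* *m A) ^t* = A ^t* *m A.
Proof. by rewrite trmx_mul map_mxM/= trmxCK. Qed.

Let gram n c := (rcirc n c) ^t* *m rcirc n c.

Let eigvec_gram n c j :
  eigvec n j *m gram n c = (sqr_eigen_modulus n c j)%:C *: eigvec n j.
Proof.
by rewrite mulmxA eigvec_mul_adj -scalemxAl eigvec_mul scalerA eigval_normE.
Qed.

Let gram_eigvec n c j :
  gram n c *m (eigvec n j)^t* = (sqr_eigen_modulus n c j)%:C *: (eigvec n j)^t*.
Proof.
rewrite -[gram n c]trCmx_mul_adj_self -/(gram n c) -map_mxM -trmx_mul eigvec_gram.
by rewrite linearZ/= map_mxZ/= conj_real_complex.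
Qed.

(** Fourier inversion: multiply the [j]-th relation by [cis (angle n j * m)] and sum over [j]; the
    orthogonality of characters leaves [n] times the [m]-th entry of [v]. *)
Let eigvec_separating n (v : 'rV[R[i]]_n) :
  (forall j : 'I_n, v *m (eigvec n j)^t* = 0) -> v = 0.
Proof.
case: n v => [|n] v h; first by apply/rowP => -[].
apply/rowP => m; rewrite mxE.
have h2 : \sum_(k < n.+1) v 0 k *
    (\sum_(j < n.+1) cis (angle n.+1 (m + n.+1 - k) * j%:R)) = 0 :> R[i].
  under eq_bigr do rewrite mulr_sumr.
  rewrite exchange_big/= big1// => j _.
  have := congr1 (fun M : 'M[R[i]]_1 => M 0 0) (h j); rewrite !mxE => h0.
  rewrite -[RHS](mulr0 (cis (angle n.+1 j * m%:R))) -[in RHS]h0 mulr_sumr.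
  apply: eq_bigr => k _; rewrite !mxE/= conj_cis mulrCA -cisD; congr (_ * _).
  rewrite [in RHS]cisD -(cis_angleD j m)// -cisD -mulrBr -natrB.
    by congr cis; rewrite /angle; ring.
  by rewrite (leq_trans (ltnW (ltn_ord k)))// leq_addl.
have off (k : 'I_n.+1) : k != m -> v 0 k *
    (\sum_(j < n.+1) cis (angle n.+1 (m + n.+1 - k) * j%:R)) = 0 :> R[i].
  move=> km; rewrite [X in _ * X](_ : _ = 0) ?mulr0// sum_Complex.
  have [] := @sum_cos_sin_angle R n.+1 (m + n.+1 - k) isT; last by move=> -> ->.
  (* [m + n - k] lies strictly between 0 and [2 n] and differs from [n]. *)
  apply/negP => /dvdnP[q hq]; have := ltn_ord m; have := ltn_ord k.
  have : (m : nat) <> k by move=> e; move/eqP: km; apply; apply: val_inj.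
  by case: q hq => [|[|q]]; rewrite ?mulSn; lia.
move: h2; rewrite (bigD1 m)//= (big1 _ _ _ off) addr0 addKn.
rewrite (eq_bigr (fun=> 1)) => [|j _].
  move/eqP; rewrite mulf_eq0 => /orP[/eqP //|].
  by rewrite sumr_const card_ord pnatr_eq0.
rewrite -[X in cis X]add0r /angle mulfK ?pnatr_eq0// /cis cosD2pin sinD2pin.
by rewrite cos0 sin0.
Qed.

(** The singular values are exactly the moduli of the Fourier eigenvalues: an eigenvector of the
    Gram matrix for any other value would be orthogonal to all Fourier vectors, hence zero. The
    infimum is then a minimum over finitely many indices. *)
Lemma smallest_singular_value_le n c (r : R) : (0 < n)%N -> 0 <= r ->
  smallest_singular_value (rcirc n c) <= r <->
  exists j : 'I_n, sqr_eigen_modulus n c j <= r ^+ 2.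
Proof.
move=> n0 r0.
have m0 j : 0 <= sqr_eigen_modulus n c j by rewrite addr_ge0 ?sqr_ge0.
have svP (s : R) : singular_values (rcirc n c) s <->
    0 <= s /\ exists j : 'I_n, s ^+ 2 = sqr_eigen_modulus n c j.
  split=> -[s0 hs]; split=> //.
    have [v hv v0] := eigenvalueP hs.
    apply: contrapT => nex; move/eqP: v0; apply; apply: eigvec_separating => j.
    have : (s ^+ 2)%:C *: (v *m (eigvec n j)^t*) =
        (sqr_eigen_modulus n c j)%:C *: (v *m (eigvec n j)^t*).
      by rewrite scalemxAl -hv -mulmxA gram_eigvec scalemxAr.
    move/eqP; rewrite -subr_eq0 -scalerBl -rmorphB scaler_eq0.
    case/orP => [|/eqP//]; rewrite eq_complex/= eqxx andbT subr_eq0 => /eqP e.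
    by case: nex; exists j.
  case: hs => j ->; apply/eigenvalueP; exists (eigvec n j); first exact: eigvec_gram.
  apply/eqP => /rowP/(_ (Ordinal n0)); rewrite !mxE mulr0 cis0 => /eqP.
  by rewrite oner_eq0.
have hl : has_lbound (singular_values (rcirc n c)) by exists 0 => s [].
split=> [h|[j hj]].
  apply: contrapT => /forallNP hj.
  pose e := [arg min_(i < Ordinal n0) sqr_eigen_modulus n c i]%O.
  have he (i : 'I_n) : sqr_eigen_modulus n c e <= sqr_eigen_modulus n c i.
    by rewrite /e; case: arg_minP => // i' _; apply.
  have : Num.sqrt (sqr_eigen_modulus n c e) <= r.
    apply: le_trans h; apply: lb_le_inf.
      exists (Num.sqrt (sqr_eigen_modulus n c e)); apply/svP.
      by rewrite sqrtr_ge0 sqr_sqrtr//; split=> //; exists e.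
    move=> s /svP[s0 [j sj]]; rewrite -(ger0_norm s0) -sqrtr_sqr sj.
    exact: ler_wsqrtr.
  rewrite -(ger0_norm r0) -sqrtr_sqr ler_sqrt ?sqr_ge0//; exact: hj.
apply: (@le_trans _ _ (Num.sqrt (sqr_eigen_modulus n c j))).
  by apply: ge_inf => //; apply/svP; rewrite sqrtr_ge0 sqr_sqrtr//; split=> //; exists j.
by rewrite -(ger0_norm r0) -sqrtr_sqr ler_wsqrtr.
Qed.

End Spectrum.

(** * Finite sums of probabilities *)

Section FiniteAdditivity.
Context d (T : measurableType d) (R : realType) (mu : probability T R).

Lemma prob_fine (A : set T) : measurable A -> mu A = (fine (mu A))%:E.
Proof. by move=> mA; rewrite fineK// fin_num_measure. Qed.

Lemma fine_prob_ge0 (A : set T) : 0 <= fine (mu A).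
Proof. by rewrite fine_ge0. Qed.

Lemma fine_prob_le (A B : set T) : measurable A -> measurable B -> A `<=` B ->
  fine (mu A) <= fine (mu B).
Proof.
by move=> mA mB AB; rewrite -lee_fin -!prob_fine// le_measure// inE.
Qed.

Lemma fine_prob_le_sum (I : finType) (D : pred I) (F : I -> set T) (A : set T) :
  (forall i, D i -> measurable (F i)) -> measurable A ->
  (forall x, A x -> exists2 i, D i & F i x) ->
  fine (mu A) <= \sum_(i | D i) fine (mu (F i)).
Proof.
move=> mF mA AF; rewrite -lee_fin -prob_fine// -sumEFin.
have -> : (\sum_(i | D i) (fine (mu (F i)))%:E = \sum_(i | D i) mu (F i))%E.
  by apply: eq_bigr => i Di; rewrite -prob_fine//; exact: mF.
have -> : (\sum_(i | D i) mu (F i) = \sum_(i \in [set` enum D]) mu (F i))%E.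
  by rewrite -fsbig_seq ?enum_uniq// big_enum_cond/=; apply: eq_bigl => i; rewrite andbT.
apply: content_sub_fsum => //.
- by move=> i /=; rewrite mem_enum; exact: mF.
- by move=> x /AF[i Di Fx]; exists i => //=; rewrite mem_enum.
Qed.

Lemma sum_le_fine_prob (I : finType) (D : pred I) (F : I -> set T) (A : set T) :
  (forall i, measurable (F i)) -> (forall i j x, F i x -> F j x -> i = j) ->
  measurable A -> (forall i x, D i -> F i x -> A x) ->
  \sum_(i | D i) fine (mu (F i)) <= fine (mu A).
Proof.
move=> mF dF mA AF.
rewrite -lee_fin -prob_fine// -sumEFin.
have -> : (\sum_(i | D i) (fine (mu (F i)))%:E = \sum_(i | D i) mu (F i))%E.
  by apply: eq_bigr => i Di; rewrite -prob_fine//; exact: mF.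
have -> : (\sum_(i | D i) mu (F i) = \sum_(i \in [set` enum D]) mu (F i))%E.
  by rewrite -fsbig_seq ?enum_uniq// big_enum_cond/=; apply: eq_bigl => i; rewrite andbT.
rewrite -measure_fin_bigcup//; last first.
  by move=> i j _ _ [x [Fi Fj]]; exact: dF Fi Fj.
apply: le_measure; rewrite ?inE//.
  by apply: fin_bigcup_measurable.
by move=> x [i /=]; rewrite mem_enum => Di; exact: AF.
Qed.

End FiniteAdditivity.

(** * Discretization of the law *)

Section Discretization.
Context {R : realType}.
Implicit Types mu : probability R R.

Lemma tail_small mu (eps : R) : 0 < eps ->
  exists K : nat, fine (mu (~` `]- K%:R, K%:R[)) <= eps.
Proof.
move=> e0; pose F (K : nat) : set R := ~` `]- K%:R, K%:R[.
have mF K : measurable (F K) by apply: measurableC; exact: measurable_itv.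
have F0 : \bigcap_K F K = set0.
  rewrite -subset0 => x /(_ (Num.bound `|x|) I); rewrite /F/= in_itv/=.
  by rewrite -ltr_norml archi_boundP.
have : mu (F K) @[K --> \oo] --> mu (\bigcap_K F K).
  apply: nonincreasing_cvg_mu => //.
  - by rewrite -ge0_fin_numE// fin_num_measure.
  - by rewrite F0.
  - move=> m n mn; apply/subsetPset; apply: subsetC => x /=; rewrite !in_itv/=.
    by rewrite -!ltr_norml => /lt_le_trans; apply; rewrite ler_nat.
rewrite F0 measure0 => /fine_cvgP[_ /cvgrPdist_le/(_ eps e0)[K _ /(_ K (leqnn K))]].
rewrite /= sub0r normrN => h; exists K; apply: le_trans h.
exact: ler_norm.
Qed.

(** The cells are intervals of length [delta] with left endpoints [v i]. Cells with [|v i| <= M + 1]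
    carry mass at least [1 - q / 2]. Around each such [v i], the cells closer than 1/2 lie in an
    interval of radius 1 and carry at most [1 - q], so mass at least [q / 2] is left at distances
    between 1/2 and [2 * M + 2]. The product [(1 - q / 2) * (q / 2)] is at least [q / 4]. *)
Lemma discretization mu (M q delta eps : R) :
  0 < M -> 0 < q -> q < 1 -> 0 < delta -> delta <= 1 / 2 -> 0 < eps ->
  (forall u : R, fine (mu `[u - 1, u + 1]%classic) <= 1 - q) ->
  1 - q / 2 <= fine (mu `[- M, M]%classic) ->
  exists (m : nat) (v : 'I_m -> R) (C : 'I_m -> set R),
  [/\ (forall i, measurable (C i)) /\ (forall i x, C i x -> `|x - v i| <= delta),
      \sum_i fine (mu (C i)) <= 1,
      q / 4 <= \sum_i \sum_(i' | (1 / 2 <= `|v i - v i'|) &&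
        (`|v i - v i'| <= 2 * M + 2)) fine (mu (C i)) * fine (mu (C i')) &
      fine (mu (~` \bigcup_i C i)) <= eps].
Proof.
move=> M0 q0 q1 d0 d1 e0 hconc hM.
have [K0 hK0] := tail_small mu e0.
(* Large enough for the cells to cover both []- K0, K0[], whose complement has mass at most [eps],
   and [[- M, M]]. *)
pose K := Num.bound ((K0%:R + M + 1) / delta).
have hK : K0%:R + M + 1 < delta * K%:R.
  rewrite mulrC -ltr_pdivrMr//; apply: archi_boundP.
  by rewrite divr_ge0 ?(ltW d0)// !addr_ge0 ?(ltW M0).
pose v (i : 'I_(K + K)) : R := delta * (i%:R - K%:R).
pose C (i : 'I_(K + K)) : set R := `[v i, v i + delta[%classic.
have v_succ i : v i + delta = delta * (i.+1%:R - K%:R).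
  by rewrite /v -natr1; ring.
have CP i x : C i x -> v i <= x /\ x < v i + delta.
  by rewrite /C /= in_itv/= => /andP.
have mC i : measurable (C i) by exact: measurable_itv.
have cover x : `|x| < delta * K%:R -> exists i, C i x.
  rewrite ltr_norml => /andP[x1 x2].
  pose z := x / delta + K%:R.
  have xE : x = delta * (z - K%:R) by rewrite /z; field; rewrite gt_eqF.
  clearbody z.
  have z0 : 0 <= z.
    by rewrite -(pmulr_rge0 _ d0); rewrite xE mulrBr in x1; lra.
  have zK : z < (K + K)%:R.
    by rewrite -(ltr_pM2l d0) natrD mulrDr; rewrite xE mulrBr in x2; lra.
  have [t1 t2] := andP (truncn_itv z0).
  have tK : (Num.truncn z < K + K)%N by rewrite truncn_lt_nat.
  exists (Ordinal tK); rewrite /C /= in_itv/= v_succ /v xE.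
  by rewrite ler_pM2l// ltr_pM2l// lerD2r ltrD2r t1.
have disj i i' x : C i x -> C i' x -> i = i'.
  move=> /CP[a1 a2] /CP[b1 b2]; apply: val_inj => /=; apply/eqP.
  have h (a b : 'I_(K + K)) : v a < v b + delta -> (a <= b)%N.
    by rewrite v_succ /v ltr_pM2l// ltrD2r ltr_nat ltnS.
  by rewrite eqn_leq !h// ?(le_lt_trans a1)// (le_lt_trans b1).
exists (K + K)%N, v, C; split.
- split=> // i x /CP[h1 h2]; rewrite ger0_norm ?subr_ge0// lerBlDl; exact: ltW.
- have := @sum_le_fine_prob _ _ _ mu _ predT C setT mC disj measurableT (fun _ _ _ _ => I).
  by rewrite probability_setT.
- pose S i := `|v i| <= M + 1.
  pose p i := fine (mu (C i)).
  have p0 i : 0 <= p i by exact: fine_prob_ge0.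
  have hS : 1 - q / 2 <= \sum_(i | S i) p i.
    apply: le_trans hM _; apply: fine_prob_le_sum => // x.
    rewrite /= in_itv/= -ler_norml => xM.
    have [|i Ci] := cover x; first by have : 0 <= K0%:R :> R := ler0n _ _; lra.
    exists i => //; have [h1 h2] := CP _ _ Ci.
    by move: xM; rewrite /S !ler_norml => /andP[]; lra.
  have hclose i : \sum_(i' | `|v i - v i'| < 1 / 2) p i' <= 1 - q.
    apply: le_trans (hconc (v i)); apply: sum_le_fine_prob => // i' x.
    move=> hi /CP[h1 h2]; rewrite /= in_itv/=; move: hi; rewrite ltr_norml => /andP[]; lra.
  have hfar i : S i -> q / 2 <= \sum_(i' | (1 / 2 <= `|v i - v i'|) &&
        (`|v i - v i'| <= 2 * M + 2)) p i'.
    move=> Si; have := hclose i; have := hS.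
    suff : \sum_(i | S i) p i <= \sum_(i' | `|v i - v i'| < 1 / 2) p i' +
      \sum_(i' | (1 / 2 <= `|v i - v i'|) && (`|v i - v i'| <= 2 * M + 2)) p i'.
      lra.
    rewrite [leLHS]big_mkcond [X in _ <= X + _]big_mkcond [X in _ <= _ + X]big_mkcond.
    rewrite -big_split/=.
    apply: ler_sum => i' _; case: ifPn => Si'; last first.
      by rewrite addr_ge0//; case: ifP.
    have := ler_normB (v i) (v i'); move: Si Si'; rewrite /S => Si Si' vv.
    have -> : `|v i - v i'| <= 2 * M + 2 by lra.
    by rewrite andbT; case: ltP; rewrite ?addr0 ?add0r.
  apply: (@le_trans _ _ (\sum_(i | S i) p i * (q / 2))).
    by rewrite -mulr_suml; nra.
  rewrite [leLHS]big_mkcond/=; apply: ler_sum => i _; case: ifPn => Si.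
    by rewrite -mulr_sumr ler_wpM2l// hfar.
  by apply: sumr_ge0 => i' _; apply: mulr_ge0; exact: p0.
- apply: le_trans hK0; apply: fine_prob_le.
  + by apply/measurableC/fin_bigcup_measurable => //; exact: finite_finset.
  + by apply: measurableC; exact: measurable_itv.
  + apply: subsetC => x; rewrite /= in_itv/= -ltr_norml => xK.
    have [|i Ci] := cover x; first by lra.
    by exists i.
Qed.

End Discretization.

(** * Events of independent variables and cells of the discretization *)

Section IndependentEvents.
Context d (T : measurableType d) (R : realType) (P : probability T R).
Variables (xi : {RV P >-> R}) (xis : nat -> {RV P >-> R}).
Hypothesis xis_independent : independent xis.
Hypothesis xis_distribution : forall k, equal_in_distribution (xis k) xi.

Let law : probability R R := distribution P xi.

Lemma measurable_preimage k (A : set R) : measurable A -> measurable (xis k @^-1` A).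
Proof. by move=> mA; exact: measurable_funPTI. Qed.

Lemma fine_prob_box n (A : 'I_n -> set R) : (forall k, measurable (A k)) ->
  fine (P [set t | forall k : 'I_n, A k (xis k t)]) =
  \prod_(k < n) fine (law (A k)).
Proof.
move=> mA.
(* Independence speaks of families indexed by [nat]; [setT] is the default value from the index [n]
   on. *)
pose A' (k : nat) : set R := if insub k is Some k' then A k' else setT.
have A'E (k : 'I_n) : A' k = A k by rewrite /A' valK.
have mA' k : measurable (A' k) by rewrite /A'; case: insub.
pose J : {fset nat} := [fset x in iota 0 n]%fset.
have := xis_independent J mA'.
have -> : \bigcap_(k in [set` J]) (xis k @^-1` A' k) =
    [set t | forall k : 'I_n, A k (xis k t)].
  apply/seteqP; split => t ht k.
    rewrite -A'E; apply: ht => /=; rewrite !inE /= mem_iota /=; exact: ltn_ord.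
  rewrite /= !inE /= mem_iota /= => kn.
  by have := ht (Ordinal kn); rewrite -A'E.
have -> : (\prod_(k <- J) P (xis k @^-1` A' k) = \prod_(k < n) P (xis k @^-1` A' k))%E.
  rewrite -(big_mkord predT (fun k => P (xis k @^-1` A' k))) /index_iota subn0.
  apply: perm_big; apply: uniq_perm; rewrite ?fset_uniq ?iota_uniq// => k.
  by rewrite !inE.
move=> ->.
have -> : (\prod_(k < n) P (xis k @^-1` A' k) = \prod_(k < n) (fine (law (A k)))%:E)%E.
  apply: eq_bigr => k _; rewrite A'E -prob_fine//; exact: xis_distribution.
by rewrite prodEFin.
Qed.

(** Union bound: either some variable misses all cells, which costs [eps] for each of the [n]
    indices, or the cells that are hit define an [f] satisfying [G]. *)
Lemma independent_event_le n m (C : 'I_m -> set R) (G : pred {ffun 'I_n -> 'I_m})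
    (E : set T) (eps : R) :
  measurable E -> (forall i, measurable (C i)) ->
  fine (law (~` \bigcup_i C i)) <= eps ->
  (forall t (f : {ffun 'I_n -> 'I_m}), E t -> (forall k, C (f k) (xis k t)) -> G f) ->
  fine (P E) <= n%:R * eps + \sum_(f | G f) \prod_k fine (law (C (f k))).
Proof.
move=> mE mC heps hG.
have mD : measurable (~` \bigcup_i C i).
  by apply/measurableC/fin_bigcup_measurable => //; exact: finite_finset.
pose F (u : 'I_n + {ffun 'I_n -> 'I_m}) : set T :=
  match u with
  | inl k => xis k @^-1` (~` \bigcup_i C i)
  | inr f => [set t | forall k : 'I_n, C (f k) (xis k t)]
  end.
pose D (u : 'I_n + {ffun 'I_n -> 'I_m}) := if u is inr f then G f else true.
have mF u : measurable (F u).
  case: u => [k|f] /=; first exact: measurable_preimage.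
  have -> : [set t | forall k : 'I_n, C (f k) (xis k t)] =
      \bigcap_(k in [set: 'I_n]) (xis k @^-1` C (f k)).
    by apply/seteqP; split => t h k //=; exact: h.
  by apply: fin_bigcap_measurable => [|k _]; [exact: finite_finset|exact: measurable_preimage].
apply: (@le_trans _ _ (\sum_(u | D u) fine (P (F u)))).
  apply: fine_prob_le_sum => // t Et.
  have [[k hk]|hn] := pselect (exists k : 'I_n, forall i, ~ C i (xis k t)).
    by exists (inl k) => //= -[i _]; exact: hk.
  have hc (k : 'I_n) : exists i, C i (xis k t).
    by apply: contrapT => hk; apply: hn; exists k => i Ci; apply: hk; exists i.
  have [f hf] := choice hc.
  exists (inr [ffun k => f k]) => /=; first apply: (hG t _ Et).
    by move=> k; rewrite ffunE.
  by move=> k; rewrite ffunE.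
rewrite big_sumType/=; apply: lerD.
  have -> : n%:R * eps = \sum_(k < n) eps by rewrite sumr_const card_ord mulr_natl.
  apply: ler_sum => k _; apply: le_trans heps.
  by rewrite le_eqVlt (_ : P _ = law (~` \bigcup_i C i)) ?eqxx//; exact: xis_distribution.
by apply: ler_sum => f _; rewrite (@fine_prob_box n (fun k => C (f k))).
Qed.

End IndependentEvents.

(** An index [j] is determined by the numerator and denominator of the fraction [j / n] in lowest
    terms, both at most [D] here. *)
Lemma card_small_order n D : (0 < n)%N ->
  (#|[pred j : 'I_n | (n %/ gcdn j n <= D)%N]| <= D.+1 ^ 2)%N.
Proof.
move=> n0; set A := [pred j | _].
pose f (j : 'I_n) : 'I_D.+1 * 'I_D.+1 := (inord (j %/ gcdn j n), inord (n %/ gcdn j n)).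
have g0 (j : 'I_n) : (0 < gcdn j n)%N by rewrite gcdn_gt0 n0 orbT.
have f_inj : {in A &, injective f}.
  move=> j j'; rewrite !inE => jD j'D [].
  have lt_order (i : 'I_n) : (n %/ gcdn i n <= D)%N -> (i %/ gcdn i n < D.+1)%N.
    by move=> iD; rewrite ltnS (leq_trans _ iD)// leq_div2r// ltnW.
  move/(congr1 val); rewrite /= !inordK ?lt_order// => e1.
  move/(congr1 val); rewrite /= !inordK// => e2.
  have e3 : gcdn j n = gcdn j' n.
    have nj : (0 < n %/ gcdn j n)%N by rewrite divn_gt0// dvdn_leq// dvdn_gcdr.
    apply/eqP; rewrite -(eqn_pmul2l nj) {2}e2.
    by rewrite !divnK ?dvdn_gcdr.
  apply: val_inj; rewrite /= -(divnK (dvdn_gcdl j n)) e1 e3.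
  by rewrite (divnK (dvdn_gcdl j' n)).
rewrite -(card_in_image f_inj); apply: (leq_trans (max_card _)).
by rewrite card_prod !card_ord mulnn.
Qed.

(** * Small-ball probabilities of the eigenvalues and their sum *)

Section EigenEvents.
Context d (T : measurableType d) (R : realType) (P : probability T R).
Variables (xi : {RV P >-> R}) (xis : nat -> {RV P >-> R}).
Hypothesis xis_independent : independent xis.
Hypothesis xis_distribution : forall k, equal_in_distribution (xis k) xi.

Let law : probability R R := distribution P xi.

Definition eigen_event n j (r : R) : set T :=
  [set t | sqr_eigen_modulus n (fun k => xis k t) j <= r ^+ 2].

Lemma measurable_eigen_event n j r : measurable (eigen_event n j r).
Proof.
have -> : eigen_event n j r =
    (fun t => sqr_eigen_modulus n (fun k => xis k t) j) @^-1` `]-oo, r ^+ 2]%classic.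
  by apply/seteqP; split => t; rewrite /= in_itv.
rewrite -[X in measurable X]setTI.
suff : measurable_fun [set: T] (fun t => sqr_eigen_modulus n (fun k => xis k t) j).
  by apply => //; exact: measurable_itv.
by apply: measurable_funD; apply: measurable_funX; apply: measurable_sum => k;
  apply: measurable_funM => //; exact: measurable_funP.
Qed.

Lemma norm_grid_frequency_le n j N N2 (h : R) (l : 'I_N * 'I_N2) (k : 'I_n) :
  (N2 <= N)%N -> 0 <= h ->
  `|@grid_frequency R n j N N2 h l k| <= 2 * (h * N%:R).
Proof.
move=> N2N h0; rewrite /grid_frequency normrM (ger0_norm h0) mulrCA ler_wpM2l//.
apply: (le_trans (ler_normD _ _)); rewrite !normrM !normr_nat [leRHS]mulr_natl mulr2n.
have hl (i x : R) : 0 <= i -> i <= N%:R -> `|x| <= 1 -> i * `|x| <= N%:R.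
  by move=> i0 iN x1; apply: le_trans iN; rewrite ler_piMr.
apply: lerD; apply: hl => //.
- by rewrite ler_nat ltnW.
- exact: cos_max.
- by rewrite ler_nat (leq_trans (ltnW (ltn_ord _))).
- exact: sin_max.
Qed.

Lemma sum_grid_frequency n j N N2 (h : R) (l : 'I_N * 'I_N2) (c : nat -> R) :
  \sum_(k < n) @grid_frequency R n j N N2 h l k * c k =
  h * (l.1%:R * \sum_(k < n) c k * cos (angle n j * k%:R) +
       l.2%:R * \sum_(k < n) c k * sin (angle n j * k%:R)).
Proof.
rewrite !mulr_sumr -big_split/= mulr_sumr; apply: eq_bigr => k _.
by rewrite /grid_frequency; ring.
Qed.

Lemma norm_sum_grid_frequency_le n j N N2 (h r : R) (l : 'I_N * 'I_N2) (c : nat -> R) :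
  (N2 <= N)%N -> 0 <= h -> 0 <= r -> sqr_eigen_modulus n c j <= r ^+ 2 ->
  `|\sum_(k < n) @grid_frequency R n j N N2 h l k * c k| <= 2 * (h * N%:R) * r.
Proof.
move=> N2N h0 r0; rewrite sum_grid_frequency /sqr_eigen_modulus.
set x := \sum_(k < n) _; set y := \sum_(k < n) _ => hxy.
have sqr_le (z : R) : z ^+ 2 <= r ^+ 2 -> `|z| <= r.
  by move=> hz; rewrite -(ger0_norm r0) -!sqrtr_sqr ler_wsqrtr.
have xr : `|x| <= r by apply: sqr_le; have := sqr_ge0 y; lra.
have yr : `|y| <= r by apply: sqr_le; have := sqr_ge0 x; lra.
rewrite normrM (ger0_norm h0) -!mulrA mulrCA ler_wpM2l//.
apply: (le_trans (ler_normD _ _)); rewrite !normrM !normr_nat.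
rewrite [leRHS]mulr_natl mulr2n.
apply: lerD; apply: ler_pM => //; rewrite ler_nat.
  exact: ltnW.
by rewrite (leq_trans (ltnW (ltn_ord _))).
Qed.

Variables (M q : R).
Hypotheses (M_gt0 : 0 < M) (q_gt0 : 0 < q) (q_lt1 : q < 1).
Hypothesis concentration : forall u : R, fine (law `[u - 1, u + 1]%classic) <= 1 - q.
Hypothesis tail : 1 - q / 2 <= fine (law `[- M, M]%classic).

Let B : R := 2 * M + 2.

(** The grid has step [Y / N]. On the event, the phases are at most [2 * Y * r <= 1 / 2], which
    leaves 1/2 for the discretization error. The upper bound on [N] is the step condition of
    [grid_concentration_le]. *)
Lemma eigen_event_le n j N N2 (Y r : R) :
  (0 < n)%N -> (0 < N2)%N -> (N2 <= N)%N -> 0 < Y -> 0 <= r -> Y * r <= 1 / 4 ->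
  N%:R <= 2 * Y * Num.sqrt n%:R ->
  (forall (a a' : 'I_N) (b b' : 'I_N2), phase_lower_bound n j B
     (Y / N%:R * (a%:R - a'%:R)) (Y / N%:R * (b%:R - b'%:R))) ->
  fine (P (eigen_event n j r)) <= (n%:R ^+ 2)^-1 +
    4 * (expR (- (q / 4 / 2048) * n%:R) +
       (2 / (1 - expR (- (q / 4 / 512)))) ^+ 2 / (N%:R * N2%:R)).
Proof.
move=> n0 N20 N2N Y0 r0 Yr hN hph.
have N0 : (0 < N)%N by exact: leq_trans N2N.
have NR : 0 < N%:R :> R by rewrite ltr0n.
have nR : 0 < n%:R :> R by rewrite ltr0n.
pose h := Y / N%:R.
have h0 : 0 < h by rewrite divr_gt0.
have hNE : h * N%:R = Y by rewrite /h divfK// gt_eqF.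
(* Each of the [n] coefficients is at most [2 * Y], so the discretization moves a phase by at most
   [2 * n * Y * delta <= 1 / 2]. *)
pose delta := Num.min (1 / 2) (1 / (4 * n%:R * Y)).
have d0 : 0 < delta.
  by rewrite lt_min; apply/andP; split; apply: divr_gt0 => //; rewrite !mulr_gt0.
have d1 : delta <= 1 / 2 by rewrite ge_min lexx.
have d2 : delta * (4 * n%:R * Y) <= 1.
  rewrite -ler_pdivlMr ?mulr_gt0//; by rewrite ge_min lexx orbT.
(* The loss [eps = n ^ -3] for each variable adds up to [n ^ -2]. *)
have e0 : 0 < (n%:R ^+ 3)^-1 :> R by rewrite invr_gt0 exprn_gt0.
have [m [v [C [[mC vC] p1 hk heps]]]] :=
  discretization M_gt0 q_gt0 q_lt1 d0 d1 e0 concentration tail.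
pose p i := fine (law (C i)).
pose G (f : {ffun 'I_n -> 'I_m}) :=
  [forall l : 'I_N * 'I_N2, `|\sum_k @grid_frequency R n j N N2 h l k * v (f k)| <= 1].
apply: le_trans (@independent_event_le _ _ _ _ _ _ xis_independent xis_distribution
   n m C G _ _ (measurable_eigen_event n j r) mC heps _) _.
  move=> t f Et hC; apply/forallP => l.
  have -> : \sum_k grid_frequency j h l k * v (f k) =
      \sum_(k < n) grid_frequency j h l k * xis k t -
      \sum_(k < n) grid_frequency j h l k * (xis k t - v (f k)).
    by rewrite -sumrB; apply: eq_bigr => k _; ring.
  apply: (le_trans (ler_normB _ _)).
  have h1 : `|\sum_(k < n) grid_frequency j h l k * xis k t| <= 1 / 2.
    apply: (le_trans (norm_sum_grid_frequency_le l N2N (ltW h0) r0 Et)).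
    by rewrite hNE; lra.
  have h2 : `|\sum_(k < n) grid_frequency j h l k * (xis k t - v (f k))| <= 1 / 2.
    apply: (le_trans (ler_norm_sum _ _ _)).
    apply: (@le_trans _ _ (\sum_(k < n) 2 * Y * delta)).
      apply: ler_sum => k _; rewrite normrM ler_pM//; last exact: vC.
      by rewrite -hNE norm_grid_frequency_le// ltW.
    by rewrite sumr_const card_ord -[leLHS]mulr_natl; nra.
  lra.
apply: lerD.
  by rewrite exprS invfM mulrA mulfV ?mul1r// gt_eqF.
apply: (@grid_concentration_le R 'I_m n j N N2 h B (q / 4) p v G) => //.
- by rewrite divr_gt0.
- have s0 : 0 <= Num.sqrt n%:R :> R by exact: sqrtr_ge0.
  have sE : Num.sqrt n%:R ^+ 2 = n%:R :> R by rewrite sqr_sqrtr.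
  have : 1 / 2 <= Num.sqrt n%:R * h.
    by rewrite /h mulrA ler_pdivlMr//; lra.
  move=> sh; rewrite -sE -exprMn.
  have -> : 1 / 4 = (1 / 2) ^+ 2 :> R by field.
  by apply: lerXn2r => //; rewrite nnegrE; [exact: divr_ge0|exact: le_trans sh].
- by move=> i; exact: fine_prob_ge0.
- by move=> f /forallP.
Qed.

(** The basic grid radius. As [B * Y0 <= 1 / 4], differences of values times frequencies within this
    radius stay in the range of the quadratic phase bounds. *)
Let Y0 : R := 1 / (4 * (B + 1)).
Let cA : R := (2 / (1 - expR (- (q / 4 / 512)))) ^+ 2.
Let c1 : R := q / 4 / 2048.

Let B_gt0 : 0 < B. Proof. by apply: addr_gt0 => //; exact: mulr_gt0. Qed.
Let Y0_gt0 : 0 < Y0.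
Proof. by apply: divr_gt0 => //; apply: mulr_gt0 => //; have := B_gt0; lra. Qed.
Let BY0_le : B * Y0 <= 1 / 4.
Proof. by have := B_gt0; rewrite /Y0 mulrA mulr1 => b0; rewrite ler_pdivrMr; lra. Qed.
Let Y0_le : Y0 <= 1 / 4.
Proof. by have := B_gt0; rewrite /Y0 => b0; rewrite ler_pdivrMr; lra. Qed.
Let cA_ge0 : 0 <= cA. Proof. exact: sqr_ge0. Qed.

Lemma grid_size_exists n (Y : R) : 1 <= Y * Num.sqrt n%:R ->
  exists N : nat, [/\ (0 < N)%N, Y * Num.sqrt n%:R <= N%:R &
    N%:R <= 2 * Y * Num.sqrt n%:R].
Proof.
move=> h; have h0 : 0 <= Y * Num.sqrt n%:R by apply: le_trans h.
have /andP[t1 t2] := truncn_itv h0.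
by exists (Num.truncn (Y * Num.sqrt n%:R)).+1; split => //; rewrite -?natr1; lra.
Qed.

Lemma sqr_grid_difference_le N (Y : R) (a a' : 'I_N) : 0 <= Y ->
  (Y / N%:R * (a%:R - a'%:R)) ^+ 2 <= Y ^+ 2.
Proof.
move=> Yge0; have NR : 0 < N%:R :> R by rewrite ltr0n (leq_ltn_trans _ (ltn_ord a)).
rewrite mulrAC -mulrA exprMn ler_piMr ?sqr_ge0//.
rewrite -(real_normK (num_real _)) expr_le1// normrM normfV normr_nat.
rewrite ler_pdivrMr// mul1r ler_norml.
have : a%:R < N%:R :> R by rewrite ltr_nat.
have : a'%:R < N%:R :> R by rewrite ltr_nat.
have : 0 <= a%:R :> R by [].
have : 0 <= a'%:R :> R by [].
by move=> h1 h2 h3 h4; apply/andP; split; lra.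
Qed.

Let weight_bounds (w : R) : 1 / 2 <= `|w| -> `|w| <= B ->
  1 / 4 <= w ^+ 2 /\ w ^+ 2 * Y0 ^+ 2 <= 1 / 16.
Proof.
rewrite -(real_normK (num_real w)) => w1 w2; split; first by nra.
have : `|w| * Y0 <= 1 / 4 by apply: le_trans BY0_le; rewrite ler_wpM2r// ltW.
have : 0 <= `|w| * Y0 by rewrite mulr_ge0// ltW.
by rewrite -exprMn; nra.
Qed.

(** The eigenvalue is real, so the grid has a single point in the second direction and about
    [Y0 * sqrt n] points in the first. *)
Lemma eigen_event_degenerate_le n j (r : R) :
  (0 < n)%N -> (n %| j * 2)%N -> 0 <= r -> r <= 1 -> 1 <= Y0 * Num.sqrt n%:R ->
  fine (P (eigen_event n j r)) <=
  (n%:R ^+ 2)^-1 + 4 * (expR (- c1 * n%:R) + cA / (Y0 * Num.sqrt n%:R)).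
Proof.
move=> n0 nj r0 r1 hn; have [N [N0 N1 N2]] := grid_size_exists hn.
have nR : 0 < n%:R :> R by rewrite ltr0n.
have y0 := Y0_gt0.
apply: le_trans (@eigen_event_le n j N 1 Y0 r n0 isT N0 Y0_gt0 r0 _ N2 _) _.
- by have := Y0_le; nra.
- move=> a a' b b' w w1 w2; rewrite !ord1 subrr mulr0 mulr0 expr0n addr0.
  set z := Y0 / N%:R * _.
  have hz : z ^+ 2 <= Y0 ^+ 2 by apply: sqr_grid_difference_le; exact: ltW.
  clearbody z; have [w3 w4] := weight_bounds w1 w2.
  have z0 := sqr_ge0 z.
  have wz : w ^+ 2 * z ^+ 2 <= 1.
    by apply: (@le_trans _ _ (w ^+ 2 * Y0 ^+ 2)); [rewrite ler_wpM2l// sqr_ge0|lra].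
  apply: le_trans (phase_sum_degenerate nj _); last by rewrite exprMn.
  rewrite ge_min; apply/orP; left; rewrite exprMn.
  have : 1 / 4 * (n%:R * z ^+ 2) <= w ^+ 2 * (n%:R * z ^+ 2).
    by apply: ler_wpM2r => //; apply: mulr_ge0.
  have : 0 <= n%:R * z ^+ 2 by apply: mulr_ge0.
  by lra.
rewrite lerD2l; apply: ler_wpM2l => //; rewrite lerD2l mulr1.
apply: ler_wpM2l => //; rewrite lef_pV2 ?posrE ?ltr0n//.
exact: lt_le_trans hn.
Qed.

(** The grid has radius [x * Y0] and at least [x ^ 2 * Y0 ^ 2 * n] points. For [x = 1] the scaled
    frequencies have length at most 1 and [phase_sum_small] suffices; otherwise
    [n / gcd (j, n) >= 4 x] lets [phase_sum_large] handle the longer ones. *)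
Lemma eigen_event_generic_le n j (x r : R) :
  (0 < n)%N -> ~~ (n %| j * 2)%N -> 1 <= x -> 0 <= r -> x * r <= 1 ->
  1 <= Y0 * Num.sqrt n%:R ->
  x = 1 \/ 16 * (gcdn j n)%:R ^+ 2 * x ^+ 2 <= n%:R ^+ 2 ->
  fine (P (eigen_event n j r)) <=
  (n%:R ^+ 2)^-1 + 4 * (expR (- c1 * n%:R) + cA / (x ^+ 2 * Y0 ^+ 2 * n%:R)).
Proof.
move=> n0 nj x1 r0 xr hn hx.
have nR : 0 < n%:R :> R by rewrite ltr0n.
have y0 := Y0_gt0.
have sq0 : 0 <= Num.sqrt n%:R :> R by exact: sqrtr_ge0.
have x0 : 0 < x by exact: lt_le_trans x1.
have xY0 : 0 < x * Y0 by exact: mulr_gt0.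
have hn' : 1 <= x * Y0 * Num.sqrt n%:R by rewrite -mulrA; nra.
have [N [N0 N1 N2]] := grid_size_exists hn'.
have NR : 0 < N%:R :> R by rewrite ltr0n.
apply: le_trans (@eigen_event_le n j N N (x * Y0) r n0 N0 (leqnn N) xY0 r0 _ N2 _) _.
- rewrite mulrAC; have := Y0_le; have : 0 <= x * r by apply: mulr_ge0 => //; exact: ltW.
  by nra.
- move=> a a' b b' w w1 w2.
  set z1 := x * Y0 / N%:R * (a%:R - _); set z2 := x * Y0 / N%:R * (b%:R - _).
  have hz1 : z1 ^+ 2 <= (x * Y0) ^+ 2 by apply: sqr_grid_difference_le; exact: ltW.
  have hz2 : z2 ^+ 2 <= (x * Y0) ^+ 2 by apply: sqr_grid_difference_le; exact: ltW.
  clearbody z1 z2; have [w3 w4] := weight_bounds w1 w2.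
  pose z := z1 ^+ 2 + z2 ^+ 2.
  have z0 : 0 <= z by apply: addr_ge0; exact: sqr_ge0.
  have wE : (w * z1) ^+ 2 + (w * z2) ^+ 2 = w ^+ 2 * z by rewrite !exprMn /z mulrDr.
  (* Two coordinates, each at most [x * Y0] in modulus, and [w ^ 2 * Y0 ^ 2 <= 1 / 16]. *)
  have wz : w ^+ 2 * z <= x ^+ 2 / 8.
    apply: (@le_trans _ _ (w ^+ 2 * (2 * (x * Y0) ^+ 2))).
      by apply: ler_wpM2l; [exact: sqr_ge0|rewrite /z; lra].
    have -> : w ^+ 2 * (2 * (x * Y0) ^+ 2) = 2 * x ^+ 2 * (w ^+ 2 * Y0 ^+ 2) by ring.
    by have := sqr_ge0 x; nra.
  rewrite ge_min; apply/orP.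
  have [wz1|wz1] := leP (w ^+ 2 * z) 1.
    left; apply: le_trans (phase_sum_small n0 nj _); last by rewrite wE.
    rewrite wE.
    have : 1 / 4 * (n%:R * z) <= w ^+ 2 * (n%:R * z).
      by apply: ler_wpM2r => //; apply: mulr_ge0.
    by rewrite -/z; lra.
  right; apply: phase_sum_large n0 nj _ _; rewrite wE; first exact: ltW.
  case: hx => [xE|hx]; first by move: wz wz1; rewrite xE expr1n; lra.
  have pi4 : pi <= 4 :> R by have := @pihalf_lt2 R; lra.
  (* [pi <= 4] gives [(2 pi g) ^ 2 <= 64 g ^ 2], and [64 / 8 <= 16]. *)
  apply: (@le_trans _ _ (64 * (gcdn j n)%:R ^+ 2 * (x ^+ 2 / 8))).
    apply: ler_pM => //; [exact: sqr_ge0|exact: mulr_ge0 (sqr_ge0 _) z0|].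
    have := @pi_ge0 R; have := sqr_ge0 ((gcdn j n)%:R : R).
    set g := (gcdn j n)%:R => g2 p0; rewrite exprMn; apply: ler_wpM2r => //.
    by nra.
  by apply: le_trans hx; have := mulr_ge0 (sqr_ge0 ((gcdn j n)%:R : R)) (sqr_ge0 x); lra.
rewrite lerD2l; apply: ler_wpM2l => //; rewrite lerD2l.
have D0 : 0 < x ^+ 2 * Y0 ^+ 2 * n%:R.
  by apply: mulr_gt0 => //; apply: mulr_gt0; exact: exprn_gt0.
apply: ler_wpM2l => //; rewrite lef_pV2 ?posrE//; last exact: mulr_gt0.
have -> : x ^+ 2 * Y0 ^+ 2 * n%:R = (x * Y0 * Num.sqrt n%:R) ^+ 2.
  by rewrite !exprMn sqr_sqrtr// ltW.
rewrite -expr2; apply: lerXn2r => //; rewrite nnegrE; last exact: ltW.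
exact: le_trans hn'.
Qed.

Lemma sum_eigen_event_le : exists K : R, forall n (X : R),
  (0 < n)%N -> 1 <= X -> X ^+ 4 <= n%:R -> 1 <= Y0 * Num.sqrt n%:R ->
  \sum_(j < n) fine (P (eigen_event n j X^-1)) <= K / X ^+ 2.
Proof.
(* The summands come from the terms common to all indices, from at most 9 indices of order at most 2
   ([9 * 4 = 36]), and from at most [25 * X ^ 2] indices of order at most [4 * X] together with the
   generic bound ([25 * 4 + 4 = 104]). *)
exists (1 + 8 / c1 ^+ 2 + 36 * cA / Y0 + 104 * cA / Y0 ^+ 2) => n X n0 X1 X4 hn.
have X0 : 0 < X by exact: lt_le_trans X1.
have nR : 0 < n%:R :> R by rewrite ltr0n.
have y0 := Y0_gt0.
have c10 : 0 < c1.
  by rewrite /c1; apply: divr_gt0; [apply: divr_gt0; [exact: q_gt0|]|]; rewrite ltr0n.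
have X20 : 0 < X ^+ 2 by exact: exprn_gt0.
have X2n : X ^+ 2 <= n%:R.
  have X21 : 1 <= X ^+ 2 by exact: exprn_ege1.
  by apply: le_trans X4; rewrite (exprM X 2 2); nra.
have X2s : X ^+ 2 <= Num.sqrt n%:R.
  by rewrite -(ger0_norm (ltW X20)) -sqrtr_sqr ler_wsqrtr// -exprM.
have s0 : 0 < Num.sqrt n%:R :> R by rewrite sqrtr_gt0.
have r0 : 0 <= X^-1 by rewrite invr_ge0 ltW.
have r1 : X^-1 <= 1 by rewrite invf_le1.
(* An order above [D] exceeds [4 * X], as the generic bound with [x = X] requires. *)
pose D := Num.truncn (4 * X).
have X40 : 0 <= 4 * X by lra.
have [D1 D2] := andP (truncn_itv X40).
pose base := (n%:R ^+ 2)^-1 + 4 * expR (- c1 * n%:R).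
pose a1 := 4 * (cA / (Y0 * Num.sqrt n%:R)).
pose a2 := 4 * (cA / (Y0 ^+ 2 * n%:R)).
pose a3 := 4 * (cA / (X ^+ 2 * Y0 ^+ 2 * n%:R)).
have a1_ge0 : 0 <= a1.
  by apply: mulr_ge0 => //; apply: divr_ge0 => //; apply: mulr_ge0; exact: ltW.
have a2_ge0 : 0 <= a2.
  by apply: mulr_ge0 => //; apply: divr_ge0 => //; apply: mulr_ge0 => //; exact: sqr_ge0.
have a3_ge0 : 0 <= a3.
  apply: mulr_ge0 => //; apply: divr_ge0 => //; apply: mulr_ge0; last exact: ltW.
  by apply: mulr_ge0; exact: sqr_ge0.
pose order (j : 'I_n) := (n %/ gcdn j n)%N.
have each (j : 'I_n) : fine (P (eigen_event n j X^-1)) <= base +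
   (if (order j <= 2)%N then a1 else 0) + (if (order j <= D)%N then a2 else 0) + a3.
  have g0 : (0 < gcdn j n)%N by rewrite gcdn_gt0 n0 orbT.
  have [nj|nj] := boolP (n %| j * 2)%N.
    (* [n] divides [2 j] and [2 n], hence [2 gcd (j, n)], so the order divides 2. *)
    have -> : (order j <= 2)%N.
      rewrite dvdn_leq// dvdn_divLR ?dvdn_gcdr// mulnC.
      by rewrite -[2%N]/(2%N) muln_gcdl dvdn_gcd nj dvdn_mulr.
    have := eigen_event_degenerate_le n0 nj r0 r1 hn; rewrite -/c1 -/cA.
    have : 0 <= (if (order j <= D)%N then a2 else 0) by case: ifP.
    by rewrite /base /a1; lra.
  have i2 : 0 <= (if (order j <= 2)%N then a1 else 0) by case: ifP.
  have [oD|oD] := leqP (order j) D.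
    have := @eigen_event_generic_le n j 1 X^-1 n0 nj (lexx _) r0 _ hn (or_introl erefl).
    rewrite mul1r expr1n mul1r => /(_ r1).
    by rewrite /base /a2; lra.
  have := @eigen_event_generic_le n j X X^-1 n0 nj X1 r0 _ hn.
  rewrite divff ?gt_eqF// => /(_ (lexx _)) h.
  suff : 16 * (gcdn j n)%:R ^+ 2 * X ^+ 2 <= n%:R ^+ 2 :> R.
    by move=> /(@or_intror (X = 1)) /h; rewrite /base /a3 addr0; lra.
  have -> : 16 * (gcdn j n)%:R ^+ 2 * X ^+ 2 = (4 * X * (gcdn j n)%:R) ^+ 2 :> R by ring.
  have gX : 0 <= 4 * X * (gcdn j n)%:R by exact: mulr_ge0.
  apply: lerXn2r; rewrite ?nnegrE ?ler0n//.
  have -> : n%:R = (order j)%:R * (gcdn j n)%:R :> R.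
    by rewrite -natrM /order divnK// dvdn_gcdr.
  apply: ler_wpM2r => //; apply: (le_trans (ltW D2)).
  by rewrite ler_nat.
have card_sum (k : nat) (a : R) : 0 <= a ->
    \sum_(j < n) (if (order j <= k)%N then a else 0) <= (k.+1 ^ 2)%:R * a.
  move=> a0; rewrite -big_mkcond/= sumr_const -[leLHS]mulr_natl.
  by apply: ler_wpM2r => //; rewrite ler_nat; exact: card_small_order.
have t1 : base *+ n <= (1 + 8 / c1 ^+ 2) / X ^+ 2.
  apply: (@le_trans _ _ ((1 + 8 / c1 ^+ 2) / n%:R)); last first.
    apply: ler_wpM2l; last by rewrite lef_pV2 ?posrE.
    by apply: addr_ge0 => //; apply: divr_ge0 => //; exact: sqr_ge0.
  rewrite -[leLHS]mulr_natl ler_pdivlMr// /base mulrDr mulrDl.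
  apply: lerD.
    by rewrite -mulrA [_^-1 * _]mulrC mulrA -expr2 mulfV// gt_eqF// exprn_gt0.
  (* From [exp y >= y ^ 2 / 2] at [y = c1 * n], the exponential terms sum to at most
     [8 / (c1 ^ 2 * n)]. *)
  have e1 := @expR_ge1Dxn R (c1 * n%:R) 1 (mulr_ge0 (ltW c10) (ltW nR)).
  have e2 : (c1 * n%:R) ^+ 2 / 2 <= expR (c1 * n%:R) by move: e1; rewrite /factorial/=; lra.
  have e3 : expR (- c1 * n%:R) * expR (c1 * n%:R) = 1.
    by rewrite -expRD mulNr addNr expR0.
  have e4 := expR_gt0 (- c1 * n%:R).
  have e5 : expR (- c1 * n%:R) * ((c1 * n%:R) ^+ 2 / 2) <= 1.
    by have := ler_wpM2l (ltW e4) e2; rewrite e3.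
  rewrite ler_pdivlMr ?exprn_gt0//.
  have -> : n%:R * (4 * expR (- c1 * n%:R)) * n%:R * c1 ^+ 2 =
     8 * (expR (- c1 * n%:R) * ((c1 * n%:R) ^+ 2 / 2)) by field.
  lra.
have t2 : \sum_(j < n) (if (order j <= 2)%N then a1 else 0) <= 36 * cA / Y0 / X ^+ 2.
  apply: (le_trans (card_sum _ _ a1_ge0)).
  have -> : (3 ^ 2)%:R * a1 = 36 * cA / Y0 / Num.sqrt n%:R.
    by rewrite /a1; field; rewrite !gt_eqF.
  apply: ler_wpM2l; last by rewrite lef_pV2 ?posrE.
  by apply: divr_ge0; [exact: mulr_ge0|exact: ltW].
have cY : 0 <= cA / Y0 ^+ 2 by apply: divr_ge0 => //; exact: sqr_ge0.
have t3 : \sum_(j < n) (if (order j <= D)%N then a2 else 0) <= 100 * cA / Y0 ^+ 2 / X ^+ 2.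
  apply: (le_trans (card_sum _ _ a2_ge0)).
  apply: (@le_trans _ _ ((25 * X ^+ 2) * a2)).
    apply: ler_wpM2r => //; rewrite natrX.
    have -> : 25 * X ^+ 2 = (5 * X) ^+ 2 by ring.
    by apply: lerXn2r; rewrite ?nnegrE//; [lra|rewrite -natr1; lra].
  have -> : 25 * X ^+ 2 * a2 = 100 * (cA / Y0 ^+ 2) * (X ^+ 2 / n%:R).
    by rewrite /a2; field; rewrite !gt_eqF.
  have -> : 100 * cA / Y0 ^+ 2 / X ^+ 2 = 100 * (cA / Y0 ^+ 2) * (X ^+ 2)^-1 by ring.
  apply: ler_wpM2l; first exact: mulr_ge0.
  by rewrite ler_pdivrMr// ler_pdivlMl// -exprD.
have t4 : a3 *+ n = 4 * cA / Y0 ^+ 2 / X ^+ 2.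
  by rewrite -[LHS]mulr_natl /a3; field; rewrite !gt_eqF.
apply: (le_trans (ler_sum _ (fun j _ => each j))).
clearbody base; rewrite !big_split/= !sumr_const card_ord.
have -> : (1 + 8 / c1 ^+ 2 + 36 * cA / Y0 + 104 * cA / Y0 ^+ 2) / X ^+ 2 =
  (1 + 8 / c1 ^+ 2) / X ^+ 2 + 36 * cA / Y0 / X ^+ 2 +
  100 * cA / Y0 ^+ 2 / X ^+ 2 + 4 * cA / Y0 ^+ 2 / X ^+ 2 by ring.
rewrite t4 lerD2r; apply: lerD t3.
exact: lerD t1 t2.
Qed.

End EigenEvents.

(** * From the eigenvalues to the smallest singular value *)

Theorem theorem2p6 (R : realType) (d : measure_display) (T : measurableType d)
    (P : probability T R) (xi : {RV P >-> R}) (M q : R)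
    (xi_nondegenerate : ~ degenerate xi)
    (M_gt0 : 0 < M) (q_gt0 : 0 < q) (q_lt1 : q < 1)
    (xi_concentration :
      (ereal_sup [set P [set t | (`|xi t - u| <= 1)%R] | u in [set: R]]
       <= (1 - q)%:E)%E)
    (xi_tail : (P [set t | (M < `|xi t|)%R] <= (q / 2)%:E)%E)
    (xis : nat -> {RV P >-> R})
    (xis_independent : independent xis)
    (xis_distribution : forall k, equal_in_distribution (xis k) xi)
    (rho : R) (rho_gt0 : 0 < rho) (rho_lt : rho < 1 / 4) :
  (fun n : nat =>
     fine (P [set t | smallest_singular_value (random_circulant xis n t)
                      <= n%:R `^ (- rho)]))
  =O_\oo (fun n : nat => n%:R `^ (- (2 * rho)) : R).

Proof.
pose law : probability R R := distribution P xi.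
have concentration (u : R) : fine (law `[u - 1, u + 1]%classic) <= 1 - q.
  rewrite -lee_fin -prob_fine//; apply: le_trans xi_concentration.
  apply: ereal_sup_ubound; exists u => //; congr (P _).
  apply/seteqP; split => t; rewrite /= in_itv/= ler_norml => /andP[h1 h2];
    apply/andP; split; lra.
have tail : 1 - q / 2 <= fine (law `[- M, M]%classic).
  pose A := xi @^-1` `[- M, M]%classic.
  have mA : measurable A by exact: measurable_funPTI.
  have : (P (~` A) <= (q / 2)%:E)%E.
    apply: le_trans xi_tail; rewrite le_eqVlt; apply/orP; left; apply/eqP.
    congr (P _); apply/seteqP; split => t; rewrite /A /= in_itv/= -ler_norml ltNge.
      by move/negP.
    by move=> /negP.
  rewrite probability_setC// prob_fine// -EFinB lee_fin.
  by rewrite -/(law _); lra.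
have [K hK] := sum_eigen_event_le xis_independent xis_distribution
  M_gt0 q_gt0 q_lt1 concentration tail.
set Y0 := 1 / (4 * (2 * M + 2 + 1)) in hK.
have Y0_gt0 : 0 < Y0.
  by apply: divr_gt0 => //; apply: mulr_gt0 => //; have := M_gt0; lra.
(* The constant of a big O has to be positive, while the sign of [K] is not known here. *)
apply/eqO_exP; exists (Num.max K 1); first by rewrite lt_max ltr01 orbT.
near=> n.
have n0 : (0 < n)%N by near: n; exists 1%N.
have nR : 0 < n%:R :> R by rewrite ltr0n.
have n1 : 1 <= n%:R :> R by rewrite ler1n.
have nY : 1 <= Y0 * Num.sqrt n%:R.
  rewrite mulrC -ler_pdivrMr//.
  have Y1 : 0 <= 1 / Y0 by apply: divr_ge0 => //; exact: ltW.
  rewrite -(ger0_norm Y1) -sqrtr_sqr ler_wsqrtr//.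
  by near: n; exact: nbhs_infty_ger.
pose X := n%:R `^ rho.
have X1 : 1 <= X by rewrite -(powRr0 n%:R) ler_powR// ltW.
(* This is where [rho < 1 / 4] enters. *)
have X4 : X ^+ 4 <= n%:R.
  rewrite -powR_mulrn ?powR_ge0// -powRrM -[leRHS]powRr1// ler_powR//.
  by have := rho_lt; lra.
have -> : n%:R `^ (- rho) = X^-1 by rewrite powRN.
have -> : n%:R `^ (- (2 * rho)) = (X ^+ 2)^-1.
  by rewrite powRN -powR_mulrn ?powR_ge0// -powRrM [rho * _]mulrC.
have X0 : 0 < X by exact: lt_le_trans X1.
have r0 : 0 <= X^-1 by rewrite invr_ge0 ltW.
have X2 : 0 <= (X ^+ 2)^-1 by rewrite invr_ge0 exprn_ge0// ltW.
rewrite !ger0_norm//; last exact: fine_prob_ge0.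
clearbody X.
set E := [set t | _].
(* Being a finite union of eigenvalue events, [E] is measurable and the union bound applies. *)
have EE : E = \bigcup_(j : 'I_n) eigen_event xis n j X^-1.
  apply/seteqP; split => t.
    move=> Et; have [h _] := @smallest_singular_value_le R n (fun k => xis k t) _ n0 r0.
    by have [j hj] := h Et; exists j.
  case=> j _ hj; have [_ h] := @smallest_singular_value_le R n (fun k => xis k t) _ n0 r0.
  by apply: h; exists j.
have mE : measurable E.
  rewrite EE; apply: fin_bigcup_measurable => [|j _]; first exact: finite_finset.
  exact: measurable_eigen_event.
apply: (@le_trans _ _ (K / X ^+ 2)); last first.
  by apply: ler_wpM2r => //; rewrite le_max lexx.
apply: le_trans (hK n X n0 X1 X4 nY).
apply: fine_prob_le_sum => // [j _|t]; first exact: measurable_eigen_event.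
by rewrite EE => -[j _ hj]; exists j.
Unshelve. all: by end_near.
Qed.
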